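(* Let $\mu$ be a $1$-uniform measure on $(\mathbb{H},d_H)$. Then $\mu$ is proportional to $\mathcal{S}^1\llcorner L$ (the restriction of $\mathcal S^1$ to $L$), where $L$ is an affine horizontal line.
   Context: The first Heisenberg group $\mathbb{H}$ is $\mathbb{R}^3$ with the group law $(x_1,x_2,x_3)*(y_1,y_2,y_3)=(x_1+y_1,\,x_2+y_2,\,x_3+y_3-2x_1y_2+2x_2y_1)$. It is equipped with the Korányi metric $d_H(x,y)=\|x^{-1}*y\|_H$, where $\|(x_1,x_2,x_3)\|_H^4=(x_1^2+x_2^2)^2+x_3^2$. $B_H(x,r)$ is the closed $d_H$-ball with center $x$ and radius $r$. For $s\ge 0$, a nonzero Borel measure $\mu$ on $\mathbb{H}$ is $s$-uniform if there is a constant $c>0$ such that $\mu(B_H(x,r))=cr^s$ for all $x\in\operatorname{spt}\mu$ and all $r>0$. $\mathcal{S}^s$ is the $s$-dimensional spherical Hausdorff measure of $(\mathbb{H},d_H)$: $\mathcal S^s(A)=\lim_{\delta\to0}\inf\{\sum_i(\operatorname{diam}E_i)^s: A\subset\bigcup_i E_i,\ \operatorname{diam}E_i<\delta\}$, where the $E_i$ range over $d_H$-balls. An affine horizontal line is a left coset $p*\{(ta,tb,0):t\in\mathbb{R}\}$ with $p\in\mathbb{H}$ and $(a,b)\in\mathbb{R}^2\setminus\{0\}$. *)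

(* Defs.v *)
From HB Require Import structures.
From mathcomp Require Import all_boot all_order all_algebra.
From mathcomp Require Import ring lra.
From mathcomp Require Import all_classical all_reals all_analysis.
Import Order.TTheory GRing.Theory Num.Theory.
Import numFieldNormedType.Exports.

Set Implicit Arguments.
Unset Strict Implicit.
Unset Printing Implicit Defensive.

Local Open Scope classical_set_scope.
Local Open Scope ring_scope.

(* A definition, not a notation: heis R must not inherit the additive group
   and the product metric of R * R * R. *)
Definition heis (R : realType) : Type := (R * R * R)%type.

HB.instance Definition _ (R : realType) :=
  Pointed.copy (heis R) (R * R * R)%type.

Section heisenberg_group.
Variable R : realType.
Implicit Types x y z : heis R.

Definition hmul x y : heis R :=
  (x.1.1 + y.1.1, x.1.2 + y.1.2,
   x.2 + y.2 - 2 * x.1.1 * y.1.2 + 2 * x.1.2 * y.1.1).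

Definition hone : heis R := (0, 0, 0).

Definition hinv x : heis R := (- x.1.1, - x.1.2, - x.2).

Lemma hmulA : associative hmul.
Proof.
move=> [[x1 x2] x3] [[y1 y2] y3] [[z1 z2] z3]; rewrite /hmul /=.
by congr (_, _, _); ring.
Qed.

Lemma hmul1x : left_id hone hmul.
Proof.
by move=> [[x1 x2] x3]; rewrite /hmul /=; congr (_, _, _); ring.
Qed.

Lemma hmulx1 : right_id hone hmul.
Proof.
by move=> [[x1 x2] x3]; rewrite /hmul /=; congr (_, _, _); ring.
Qed.

Lemma hmulVx : left_inverse hone hinv hmul.
Proof.
by move=> [[x1 x2] x3]; rewrite /hmul /hone /=; congr (_, _, _); ring.
Qed.

Lemma hmulxV : right_inverse hone hinv hmul.
Proof.
by move=> [[x1 x2] x3]; rewrite /hmul /hone /=; congr (_, _, _); ring.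
Qed.

HB.instance Definition _ := isGroup.Build (heis R)
  hmulA hmul1x hmulx1 hmulVx hmulxV.

Definition hnorm x : R :=
  Num.sqrt (Num.sqrt ((x.1.1 ^+ 2 + x.1.2 ^+ 2) ^+ 2 + x.2 ^+ 2)).

Definition hdist x y : R := hnorm (x^-1 * y)%g.

Lemma hnorm_ge0 x : 0 <= hnorm x.
Proof. exact: sqrtr_ge0. Qed.

Lemma hnorm4 x : hnorm x ^+ 4 = (x.1.1 ^+ 2 + x.1.2 ^+ 2) ^+ 2 + x.2 ^+ 2.
Proof.
rewrite (exprM _ 2 2) sqr_sqrtr ?sqrtr_ge0// sqr_sqrtr//.
by rewrite addr_ge0 ?sqr_ge0.
Qed.

Lemma hnormV x : hnorm (x^-1)%g = hnorm x.
Proof. by rewrite /hnorm /= !sqrrN. Qed.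

Lemma hnorm_eq0 x : hnorm x = 0 -> x = 1%g.
Proof.
move=> x0; have := hnorm4 x; rewrite x0 expr0n /= => /esym/eqP.
rewrite paddr_eq0 ?sqr_ge0// !expf_eq0 /= => /andP[].
rewrite paddr_eq0 ?sqr_ge0// !expf_eq0 /=.
by case: x {x0} => [[x1 x2] x3] /= /andP[/eqP-> /eqP->] /eqP->.
Qed.

Lemma hdistxx x : hdist x x = 0.
Proof.
by rewrite /hdist mulVg /hnorm /= !expr0n /= !addr0 expr0n /= !sqrtr0.
Qed.

Lemma hdist_positivity x y : hdist x y = 0 -> x = y.
Proof. by move=> /hnorm_eq0/(congr1 (fun z => x * z)%g); rewrite mulVKg mulg1. Qed.

Lemma hdistC x y : hdist x y = hdist y x.
Proof. by rewrite /hdist -hnormV invgM invgK. Qed.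

Let minkowski2 (a b c d s t : R) : 0 <= s -> 0 <= t ->
  a ^+ 2 + b ^+ 2 <= s ^+ 2 -> c ^+ 2 + d ^+ 2 <= t ^+ 2 ->
  (a + c) ^+ 2 + (b + d) ^+ 2 <= (s + t) ^+ 2.
Proof.
move=> s0 t0 ab cd.
suff H : a * c + b * d <= s * t by nra.
apply: (le_trans (ler_norm _)).
rewrite -(ler_pXn2r (n := 2)) ?nnegrE ?mulr_ge0// real_normK ?num_real//.
have le1 : (a * c + b * d) ^+ 2 <= (a ^+ 2 + b ^+ 2) * (c ^+ 2 + d ^+ 2).
  rewrite -subr_ge0.
  have -> : (a ^+ 2 + b ^+ 2) * (c ^+ 2 + d ^+ 2) - (a * c + b * d) ^+ 2 =
    (a * d - b * c) ^+ 2 by ring.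
  exact: sqr_ge0.
by rewrite (le_trans le1)// exprMn ler_pM// addr_ge0 ?sqr_ge0.
Qed.

Lemma ler_hnormM x y : hnorm (x * y)%g <= hnorm x + hnorm y.
Proof.
have := (hnorm4 (x * y)%g, hnorm4 x, hnorm4 y).
have := (hnorm_ge0 (x * y)%g, hnorm_ge0 x, hnorm_ge0 y).
move: (hnorm (x * y)%g) (hnorm x) (hnorm y) => n s t [[n0 s0] t0] [[]].
case: x y => [[a1 a2] a3] [[b1 b2] b3] /= nE sE tE.
have A2 : a1 ^+ 2 + a2 ^+ 2 <= s ^+ 2.
  rewrite -(ler_pXn2r (n := 2)) ?nnegrE ?addr_ge0 ?sqr_ge0// -exprM sE.
  by rewrite lerDl sqr_ge0.
have B2 : b1 ^+ 2 + b2 ^+ 2 <= t ^+ 2.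
  rewrite -(ler_pXn2r (n := 2)) ?nnegrE ?addr_ge0 ?sqr_ge0// -exprM tE.
  by rewrite lerDl sqr_ge0.
have cross : (2 * (a1 * b1 + a2 * b2)) ^+ 2 +
    (2 * (a2 * b1 - a1 * b2)) ^+ 2 <= (2 * s * t) ^+ 2.
  have -> : (2 * (a1 * b1 + a2 * b2)) ^+ 2 + (2 * (a2 * b1 - a1 * b2)) ^+ 2 =
    4 * ((a1 ^+ 2 + a2 ^+ 2) * (b1 ^+ 2 + b2 ^+ 2)) by ring.
  have -> : (2 * s * t) ^+ 2 = 4 * (s ^+ 2 * t ^+ 2) by ring.
  by rewrite ler_wpM2l// ler_pM// addr_ge0 ?sqr_ge0.
have sum : (a1 ^+ 2 + a2 ^+ 2 + (b1 ^+ 2 + b2 ^+ 2)) ^+ 2 + (a3 + b3) ^+ 2 <=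
    (s ^+ 2 + t ^+ 2) ^+ 2.
  by apply: minkowski2; rewrite ?sqr_ge0 // -exprM ?sE ?tE.
have := minkowski2 (addr_ge0 (sqr_ge0 s) (sqr_ge0 t))
  (mulr_ge0 (mulr_ge0 (ler0n _ 2) s0) t0) sum cross.
have -> : (s ^+ 2 + t ^+ 2 + 2 * s * t) ^+ 2 = (s + t) ^+ 4 by ring.
move=> H; rewrite -(ler_pXn2r (n := 4)) ?nnegrE ?addr_ge0// nE.
by apply: le_trans H; rewrite le_eqVlt; apply/orP; left; apply/eqP; ring.
Qed.

Lemma hdist_triangle y x z : hdist x z <= hdist x y + hdist y z.
Proof.
rewrite /hdist.
have -> : (x^-1 * z = (x^-1 * y) * (y^-1 * z))%g by rewrite -mulgA mulVKg.
exact: ler_hnormM.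
Qed.

HB.instance Definition _ := isMetric.Build R (heis R)
  hdistxx hdist_positivity hdistC hdist_triangle.

End heisenberg_group.

Section spherical_measure.
Variables (R : realType) (T : metricType R).

(* The library's closed_ball is the closure of the open ball. *)
Definition cball (x : T) (r : R) : set T := [set y | mdist x y <= r].

Definition diam (E : set T) : \bar R :=
  ereal_sup [set (mdist x y)%:E | x in E & y in E].

(* Indexing over a set I of naturals allows finite as well as infinite
   covers. *)
Definition spherical_premeasure (s delta : R) (A : set T) : \bar R :=
  ereal_inf [set v | exists (I : set nat) (E : nat -> set T),
    [/\ forall i, I i -> exists (x : T) (r : R), 0 < r /\ E i = cball x r,
        forall i, I i -> (diam (E i) < delta%:E)%E,
        A `<=` \bigcup_(i in I) E i &
        v = (\esum_(i in I) (diam (E i) `^ s)%E)]].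

Definition spherical_measure (s : R) (A : set T) : \bar R :=
  lim (spherical_premeasure s delta A @[delta --> 0^'+]).

End spherical_measure.

Section uniform_measures.
Variable R : realType.

Definition heis_borel := g_sigma_algebraType (@open (heis R)).

HB.instance Definition _ := Measurable.on heis_borel.

Implicit Type mu : {measure set heis_borel -> \bar R}.

Definition spt mu : set (heis R) :=
  ~` \bigcup_(U in [set U : set (heis R) | open U /\ mu U = 0%E]) U.

Definition uniform_measure (s : R) mu : Prop :=
  mu setT <> 0%E /\
  exists c : R, 0 < c /\ forall (x : heis R) (r : R), spt mu x -> 0 < r ->
    mu (cball x r) = (c * r `^ s)%:E.

Definition affine_horizontal_line (L : set (heis R)) : Prop :=
  exists (p : heis R) (a b : R), (a, b) <> (0, 0) /\
    L = [set (p * ((t * a, t * b, 0)%R : heis R))%g | t in [set: R]].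

End uniform_measures.

(* Main.v *)
(* Write [S] for the support of the 1-uniform measure [mu]. The argument is metric: three
   disjoint balls of radius [h] do not fit in an annulus of mass [2 c h], so a sphere
   centred in [S] contains at most two points of [S]; it contains at least one, since balls
   of different radii have different masses. If [S] were the disjoint union of a nonempty
   compact set and a closed set, the rigidity of the masses around a nearest pair of points
   would produce two distinct midpoints of one pair of points, which the strict convexity
   of the Koranyi norm forbids. Hence, for [p, y] in [S] with [d p y = r], the part of [S]
   outside the ball [B p r] meets every sphere about [y]; packing balls along it shows that
   it takes half of the mass around [y], so [B p r] has mass [c r] only if it contains a
   point [e] of [S] with [d y e = 2 r]. Thus [p] is the midpoint of [y] and [e], and [y] lies
   on a horizontal line through [p]. As this holds for all pairs of points of [S], the set
   [S] is one horizontal line. *)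
Require Import Defs.
From mathcomp Require Import all_boot all_order all_algebra finmap.
From mathcomp Require Import ring lra.
From mathcomp Require Import all_classical all_reals all_analysis.
Import Order.TTheory GRing.Theory Num.Theory.
Import numFieldNormedType.Exports.

Set Implicit Arguments.
Unset Strict Implicit.
Unset Printing Implicit Defensive.

Local Open Scope classical_set_scope.
Local Open Scope ring_scope.

(** * Proper metric spaces *)

Section proper_metric.
Context {R : realType} {T : metricType R}.
Implicit Types (x y : T) (A B K F : set T).

Lemma lipschitz1_continuous (f : T -> R) :
  (forall x y, `|f y - f x| <= mdist x y) -> continuous f.
Proof.
move=> flip y; apply/cvgrPdist_le => e e0.
have : \forall z \near y, mdist y z < e.
  by apply: (@metricType_numDomainType.cvgr_dist_lt _ _ _ _ _ id y) => //; exact: cvg_id.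
by apply: filterS => z /ltW; apply: le_trans; rewrite distrC.
Qed.

Lemma isometric_continuous (f : R -> T) :
  (forall s t, mdist (f s) (f t) = `|t - s|) -> continuous f.
Proof.
move=> fiso t; apply/metricType_numDomainType.cvgrPdist_lt => e e0.
by apply: filterS (nbhsx_ballx t e e0) => s; rewrite /ball/= fiso distrC.
Qed.

Lemma mdist_continuous x : continuous (mdist x).
Proof.
apply: lipschitz1_continuous => y z; rewrite ler_norml; apply/andP.
have := metric_triangle x y z; have := metric_triangle x z y.
by rewrite (metric_sym z y); lra.
Qed.

Lemma closed_cball x r : closed (cball x r).
Proof.
apply: (@closed_comp _ _ (mdist x) [set t | t <= r]); last exact: closed_le.
by move=> y _; exact: mdist_continuous.
Qed.

Lemma closed_mdist_ge x r : closed [set y | r <= mdist x y].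
Proof.
apply: (@closed_comp _ _ (mdist x) [set t | r <= t]); last exact: closed_ge.
by move=> y _; exact: mdist_continuous.
Qed.

Lemma open_mdist_lt x r : open [set y | mdist x y < r].
Proof.
by apply: (@open_comp _ _ (mdist x) [set t | t < r]);
  [move=> y _; exact: mdist_continuous|exact: open_lt].
Qed.

Lemma compact_mdist_max x K : K !=set0 -> compact K ->
  exists2 z, K z & forall y, K y -> mdist x y <= mdist x z.
Proof.
move=> K0 Kc; have := @compact_EVT_max T R (mdist x) K K0 Kc.
case; first by apply: continuous_subspaceT; exact: mdist_continuous.
  move=> z /set_mem Kz zmax; exists z => // y Ky; apply: zmax; exact/mem_set.
Qed.

Lemma compact_mdist_min x K : K !=set0 -> compact K ->
  exists2 z, K z & forall y, K y -> mdist x z <= mdist x y.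
Proof.
move=> K0 Kc; have := @compact_EVT_min T R (mdist x) K K0 Kc.
case; first by apply: continuous_subspaceT; exact: mdist_continuous.
  move=> z /set_mem Kz zmax; exists z => // y Ky; apply: zmax; exact/mem_set.
Qed.

Lemma closed_mdistP A x : closed A ->
  (forall e : R, 0 < e -> exists2 y, A y & mdist x y <= e) -> A x.
Proof.
move=> clA Ax; apply: clA => U /metricType_numDomainType.nbhs_mdistP[e /= e0 eU].
have [y Ay xy] := Ax (e / 2) (divr_gt0 e0 (ltr0n _ 2)).
exists y; split=> //; apply: eU => /=; rewrite (le_lt_trans xy)//; lra.
Qed.

Lemma cball_disjoint x y r s : r + s < mdist x y -> cball x r `&` cball y s = set0.
Proof.
move=> xy; apply/seteqP; split => // z [xz yz]; move: xy; rewrite ltNge => /negP; apply.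
by rewrite (le_trans (metric_triangle x z y))// lerD// metric_sym.
Qed.

Hypothesis proper : forall x r, compact (cball x r).

Lemma proper_dist_attained K F : compact K -> K !=set0 -> closed F -> F !=set0 ->
  exists p q, [/\ K p, F q & forall p' q', K p' -> F q' -> mdist p q <= mdist p' q'].
Proof.
move=> Kc [p0 Kp0] Fc [q0 Fq0].
have [k Kk kmax] := compact_mdist_max p0 (ex_intro _ p0 Kp0) Kc.
(* A point of [F] outside the ball of this radius about [p0] is farther than [mdist p0 q0] from all
   of [K], so only a compact part of [F] matters. *)
pose r := mdist p0 k + mdist p0 q0.
have cKF : compact (K `*` (cball p0 r `&` F)).
  by apply: compact_setX => //; exact: compact_closedI.
have q0r : (cball p0 r `&` F) q0.
  by split=> //; rewrite /cball/= /r lerDr mdist_ge0.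
have := @compact_EVT_min _ R (fun z : T * T => mdist z.1 z.2) _
  (ex_intro _ (p0, q0) (conj Kp0 q0r)) cKF.
case.
  apply: continuous_subspaceT => -[x y]; apply/cvgrPdist_le => e e0.
  have e2 : 0 < e / 2 by exact: divr_gt0.
  exists (ball x (e / 2), ball y (e / 2)) => /=.
    by split; exact: nbhsx_ballx.
  move=> [x' y'] /=; rewrite !ballEmdist => -[] /=.
  move: (metric_triangle x x' y) (metric_triangle x' y' y).
  move: (metric_triangle x' x y') (metric_triangle x y y').
  rewrite (metric_sym x' x) (metric_sym y' y) => *.
  by rewrite ler_norml; apply/andP; lra.
move=> [p q] /set_mem [/= Kp [rq Fq]] pqmin; exists p, q; split => // p' q' Kp' Fq'.
have [q'r|q'r] := leP (mdist p0 q') r.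
  by apply: (pqmin (p', q')); apply/mem_set.
have pq0 : mdist p q <= mdist p0 q0 by apply: (pqmin (p0, q0)); apply/mem_set.
rewrite (le_trans pq0)//; have := metric_triangle p0 p' q'; have := kmax _ Kp'.
by move: q'r; rewrite /r; lra.
Qed.

Lemma compact_closed_separated K F : compact K -> closed F -> K `&` F = set0 ->
  exists2 e : R, 0 < e & forall x y, K x -> F y -> e <= mdist x y.
Proof.
move=> Kc Fc KF.
have [[x Kx]|K0] := pselect (K !=set0); last first.
  by exists 1 => // x y Kx; case: K0; exists x.
have [[y Fy]|F0] := pselect (F !=set0); last first.
  by exists 1 => // x' y' _ Fy; case: F0; exists y'.
have [p [q [Kp Fq pq]]] := proper_dist_attained Kc (ex_intro _ x Kx) Fc (ex_intro _ y Fy).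
exists (mdist p q) => //; rewrite mdist_gt0; apply/eqP => pqE.
by have : (K `&` F) p by [split=> //; rewrite pqE]; rewrite KF.
Qed.

End proper_metric.

(** * Strict convexity of the Koranyi norm *)

Section heisenberg_geometry.
Context {R : realType}.
Implicit Types x y z : heis R.

Lemma hdist_mulgl z x y : mdist (z * x)%g (z * y)%g = mdist x y.
Proof. by rewrite /mdist/= /hdist invgM -mulgA mulKg. Qed.

(** Carries Euclidean compactness over to the Koranyi metric: the distance to [y] is a continuous
    function of the coordinates that vanishes at [y]. *)
Lemma heis_of_prod_continuous : continuous (fun y : R * R * R => y : heis R).
Proof.
move=> y; apply/metricType_numDomainType.cvgrPdist_lt => e e0.
pose P (z : R * R * R) : R := hnorm ((y : heis R)^-1 * (z : heis R))%g.
have : P z @[z --> y] --> (0 : R).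
  rewrite -(hdistxx (y : heis R)) /P /hdist /hnorm /=.
  have c1 : z.1.1 @[z --> y] --> y.1.1.
    by apply: (@cvg_comp _ _ _ fst fst _ (nbhs y.1)); [exact: cvg_fst|exact: cvg_fst].
  have c2 : z.1.2 @[z --> y] --> y.1.2.
    by apply: (@cvg_comp _ _ _ fst snd _ (nbhs y.1)); [exact: cvg_fst|exact: cvg_snd].
  have c3 : z.2 @[z --> y] --> y.2 by exact: cvg_snd.
  have cc (k : R) : (fun _ : R * R * R => k) z @[z --> y] --> k by exact: cvg_cst.
  rewrite /hmul /=.
  apply: continuous_cvg; first exact: sqrt_continuous.
  apply: continuous_cvg; first exact: sqrt_continuous.
  apply: cvgD; apply: cvgM; try apply: cvgD; try apply: cvgM;
    repeat first [exact: c1|exact: c2|exact: c3|exact: cc|apply: cvgD|apply: cvgN|apply: cvgM].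
move=> /cvgrPdist_lt/(_ _ e0); apply: filterS => z.
by rewrite sub0r normrN ger0_norm ?hnorm_ge0.
Qed.

(** The ball is a closed subset of the left translate by [x] of a compact box with sides [r], [r]
    and [r ^+ 2], as the last coordinate scales like the square of the norm. *)
Lemma heis_proper x r : compact (cball x r).
Proof.
pose g (z : R * R * R) : heis R := (x * (z : heis R))%g.
have gc : continuous g.
  move=> z; apply/metricType_numDomainType.cvgrPdist_lt => e e0.
  have /metricType_numDomainType.cvgrPdist_lt/(_ _ e0) := @heis_of_prod_continuous z.
  by apply: filterS => w; rewrite /g hdist_mulgl.
pose box : set (R * R * R) := (`[- r, r] `*` `[- r, r]) `*` `[- r ^+ 2, r ^+ 2].
apply: (@subclosed_compact _ _ (g @` box)).
- exact: closed_cball.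
- apply: continuous_compact; first exact: continuous_subspaceT.
  by apply: compact_setX; [apply: compact_setX|]; exact: segment_compact.
- move=> y; rewrite /cball /= => xy; exists (x^-1 * y)%g; last first.
    by rewrite /g mulVKg.
  move: xy; rewrite /mdist /= /hdist; set w := (x^-1 * y)%g => wr.
  have := hnorm4 w; have := hnorm_ge0 w.
  move: w (hnorm w) wr => [[a b] c] n /= nr n0 nE.
  have r0 : 0 <= r by lra.
  have n2 : n ^+ 2 <= r ^+ 2 by rewrite ler_pXn2r// nnegrE.
  have ab : a ^+ 2 + b ^+ 2 <= r ^+ 2.
    apply: le_trans n2; rewrite -(ler_pXn2r (n := 2)) ?nnegrE ?sqr_ge0//; last first.
      by rewrite addr_ge0 ?sqr_ge0.
    by rewrite -exprM nE lerDl sqr_ge0.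
  have cr : `|c| <= r ^+ 2.
    apply: le_trans n2; rewrite -(ler_pXn2r (n := 2)) ?nnegrE ?sqr_ge0//.
    by rewrite real_normK ?num_real// -exprM nE lerDr sqr_ge0.
  have ar : `|a| <= r.
    rewrite -(ler_pXn2r (n := 2)) ?nnegrE// real_normK ?num_real//.
    by rewrite (le_trans _ ab)// lerDl sqr_ge0.
  have br : `|b| <= r.
    rewrite -(ler_pXn2r (n := 2)) ?nnegrE// real_normK ?num_real//.
    by rewrite (le_trans _ ab)// lerDr sqr_ge0.
  by rewrite /box /= !in_itv /= -!ler_norml.
Qed.

(* Writing [X = (|a|^2, a3)], [Y = (|b|^2, b3)] and [Z = 2 (a . b, a /\ b)], which have
   norms [r^2], [r^2] and [2 |a| |b|], the hypothesis says [|X + Y + Z| = 4 r^2], so that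
   equality holds in the triangle inequality; [sos] makes this quantitative. *)
Lemma hnormM_eq x y r : hnorm x = r -> hnorm y = r ->
  hnorm (x * y)%g = 2 * r -> y = x /\ x.2 = 0.
Proof.
move=> xr yr xyr; have := hnorm4 x; have := hnorm4 y.
have := hnorm4 (x * y)%g; rewrite xr yr xyr.
case: x y {xr yr xyr} => [[a1 a2] a3] [[b1 b2] b3] /= h1 h2 h3.
have sos : ((a1 - b1) ^+ 2 + (a2 - b2) ^+ 2) ^+ 2 + (a3 + b3 - 2 * (a2 * b1 - a1 * b2)) ^+ 2
    + 4 * a3 ^+ 2 + 4 * b3 ^+ 2 + 2 * (a3 - b3) ^+ 2
    + 6 * (a1 ^+ 2 + a2 ^+ 2 - (b1 ^+ 2 + b2 ^+ 2)) ^+ 2 = 0.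
  transitivity (8 * (r ^+ 4 + r ^+ 4) - (2 * r) ^+ 4); last by ring.
  by rewrite h1 {1}h2 h3; ring.
have d0 : ((a1 - b1) ^+ 2 + (a2 - b2) ^+ 2) ^+ 2 = 0 /\ a3 ^+ 2 = 0 /\ b3 ^+ 2 = 0.
  move: sos (sqr_ge0 ((a1 - b1) ^+ 2 + (a2 - b2) ^+ 2)).
  move: (sqr_ge0 (a3 + b3 - 2 * (a2 * b1 - a1 * b2))) (sqr_ge0 a3) (sqr_ge0 b3).
  move: (sqr_ge0 (a3 - b3)) (sqr_ge0 (a1 ^+ 2 + a2 ^+ 2 - (b1 ^+ 2 + b2 ^+ 2))).
  by move=> *; lra.
case: d0 => /eqP + [/eqP + /eqP]; rewrite !sqrf_eq0 => /eqP d0 /eqP-> /eqP->.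
have /eqP : (a1 - b1) ^+ 2 = 0 by move: d0 (sqr_ge0 (a1 - b1)) (sqr_ge0 (a2 - b2)); lra.
rewrite sqrf_eq0 subr_eq0 => /eqP->.
have /eqP : (a2 - b2) ^+ 2 = 0 by move: d0 (sqr_ge0 (a1 - b1)) (sqr_ge0 (a2 - b2)); lra.
by rewrite sqrf_eq0 subr_eq0 => /eqP->.
Qed.

Lemma heis_midpoint x y z r : mdist x y = r -> mdist y z = r -> mdist x z = 2 * r ->
  (y^-1 * z = x^-1 * y)%g /\ (x^-1 * y)%g.2 = 0.
Proof.
move=> xy yz xz; apply: (@hnormM_eq _ _ r) => //.
by rewrite -[RHS]xz -mulgA mulVKg.
Qed.

(** By [heis_midpoint] the increments from [x] to [y] and to [w] are both horizontal with square
    [x^-1 * z]. Squaring doubles the first two coordinates, so it is injective on horizontal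
    elements. *)
Lemma heis_midpoint_unique x z y w r : mdist x y = r -> mdist y z = r ->
  mdist x w = r -> mdist w z = r -> mdist x z = 2 * r -> y = w.
Proof.
move=> xy yz xw wz xz.
have [yE y0] := heis_midpoint xy yz xz; have [wE w0] := heis_midpoint xw wz xz.
have E : ((x^-1 * y) * (x^-1 * y) = (x^-1 * w) * (x^-1 * w))%g.
  by rewrite -{2}yE -{2}wE -!mulgA !mulVKg.
apply: (mulgI (x^-1)%g).
move: E y0 w0; case: (x^-1 * y)%g (x^-1 * w)%g => [[a1 a2] a3] [[b1 b2] b3].
move=> [] E1 E2 _ /= -> ->; congr (_, _, _); lra.
Qed.

End heisenberg_geometry.

(** * Support *)

Section support.
Context {R : realType}.
Variable mu : {measure set (heis_borel R) -> \bar R}.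
Implicit Types (x y z : heis R) (A B C : set (heis_borel R)).

Lemma open_heis_measurable (U : set (heis R)) :
  open U -> measurable (U : set (heis_borel R)).
Proof. exact: sub_sigma_algebra. Qed.

Lemma closed_heis_measurable (F : set (heis R)) :
  closed F -> measurable (F : set (heis_borel R)).
Proof.
move=> Fc; rewrite -[F]setCK; apply: measurableC.
by apply: open_heis_measurable; rewrite openC.
Qed.

Lemma closed_spt : closed (spt mu).
Proof. by rewrite /spt closedC; apply: bigcup_open => U []. Qed.

Lemma spt_setC_compact0 (K : set (heis R)) :
  compact K -> K `<=` ~` spt mu -> mu.-negligible (K : set (heis_borel R)).
Proof.
rewrite /spt setCK compact_cover => Kc KS.
have [U [] //|x /KS //|X XD KX] := Kc _ [set U | open U /\ mu U = 0%E] id.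
rewrite /cover bigcup_fset in KX.
suff : mu.-negligible (\big[setU/set0]_(i <- X) (i : set (heis_borel R))).
  by apply: negligibleS; exact: KX.
rewrite big_seq; elim/big_ind : _ => [|A B|U /XD /set_mem[Uo U0]].
- exact: negligible_set0.
- exact: negligibleU.
- by apply/negligibleP => //; exact: open_heis_measurable.
Qed.

(** Properness exhausts the open complement of the support by compact sets [K n], bounded and at
    distance at least [n.+1%:R^-1] from the support. Each is negligible by a finite subcover. *)
Lemma spt_setC0 : mu (~` spt mu) = 0%E.
Proof.
have mC : measurable (~` spt mu : set (heis_borel R)).
  by apply: measurableC; exact: closed_heis_measurable closed_spt.
apply/negligibleP => //.
pose K n : set (heis R) := cball (hone R) n%:R `&`
  [set x | forall y, spt mu y -> n.+1%:R^-1 <= mdist y x].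
have KC n : K n `<=` ~` spt mu.
  by move=> x [_ xn] /xn; rewrite mdistxx leNgt invr_gt0 ltr0n.
have Kc n : compact (K n).
  apply: compact_closedI; first exact: heis_proper.
  rewrite [X in closed X](_ : _ = \bigcap_(y in spt mu) [set x | n.+1%:R^-1 <= mdist y x]) //.
  by apply: closed_bigI => y _; exact: closed_mdist_ge.
apply: (negligibleS _ (negligible_bigcup (fun n => spt_setC_compact0 (Kc n) (@KC n)))).
move=> x Sx.
have /metricType_numDomainType.nbhs_mdistP[e /= e0 eS] : nbhs x (~` spt mu).
  by apply: open_nbhs_nbhs; split=> //; rewrite openC; exact: closed_spt.
pose N := maxn (Num.bound (mdist (hone R) x)) (Num.bound e^-1).
exists N => //; split.
  rewrite /cball /= (le_trans (ltW (archi_boundP (mdist_ge0 _ _))))//.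
  by rewrite ler_nat leq_maxl.
move=> y Sy; rewrite leNgt; apply/negP => yx.
have /eS : mdist x y < e; last by apply.
rewrite metric_sym (lt_le_trans yx)// -[leRHS]invrK lef_pV2 ?posrE ?invr_gt0// ?ltr0n//.
have e1 : e^-1 <= (Num.bound e^-1)%:R by rewrite ltW ?archi_boundP ?invr_ge0 ?ltW.
rewrite (le_trans e1)//.
by rewrite ler_nat (leq_trans (leq_maxr _ _) (leqnSn _)).
Qed.

Lemma measure_sptI A : measurable A -> mu (A `&` spt mu) = mu A.
Proof.
move=> mA; have mS : measurable (spt mu : set (heis_borel R)).
  exact: closed_heis_measurable closed_spt.
rewrite (measureDI mu mA mS).
rewrite [X in (X + _)%E](_ : _ = 0%E) ?add0e//.
apply: measure_negligible; first exact: measurableD.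
have : mu.-negligible (@setC (heis_borel R) (spt mu)).
  by apply/negligibleP; [exact: measurableC|exact: spt_setC0].
by apply: negligibleS => x [].
Qed.

(** Here and in [measure_spt_setU], inclusions and disjointness are asked only on the support, where
    the mass counts below can verify them. *)
Lemma le_measure_spt A B : measurable A -> measurable B -> A `&` spt mu `<=` B ->
  (mu A <= mu B)%E.
Proof.
move=> mA mB AB; rewrite -(measure_sptI mA).
by apply: le_measure; rewrite ?inE//; apply: measurableI => //;
  exact: closed_heis_measurable closed_spt.
Qed.

Lemma measure_spt_setU A B C : measurable A -> measurable B -> measurable C ->
  A `&` B `&` spt mu = set0 -> A `&` spt mu `<=` C -> B `&` spt mu `<=` C ->
  (mu A + mu B <= mu C)%E.
Proof.
move=> mA mB mC AB AC BC; have mS := closed_heis_measurable closed_spt.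
rewrite -(measure_sptI mA) -(measure_sptI mB) -measureU; [|exact: measurableI..|].
  by apply: le_measure_spt => //; [apply: measurableU; exact: measurableI|
    by move=> x [[/AC|/BC]]].
by rewrite setIACA setIid.
Qed.

Lemma measure_spt_neq0 A : measurable A -> (0 < mu A)%E -> exists2 x, A x & spt mu x.
Proof.
move=> mA A0; apply: contrapT => H; move: A0.
rewrite -(measure_sptI mA) (_ : A `&` _ = set0) ?measure0 ?ltxx//.
by apply/seteqP; split => // x [Ax Sx]; case: H; exists x.
Qed.

End support.

(** * Geometry of the support of a 1-uniform measure *)

Section one_uniform.
Context {R : realType}.
Variable mu : {measure set (heis_borel R) -> \bar R}.
Variable c : R.
Hypothesis c0 : 0 < c.
Hypothesis mu_cball : forall (x : heis R) (r : R), spt mu x -> 0 < r ->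
  mu (cball x r) = (c * r)%:E.
Implicit Types (x y z p q : heis R) (r a b : R).
Local Notation S := (spt mu).
Local Notation d := mdist.
Local Notation oball x r := [set y : heis R | (d x y < r%R)%R].
Local Notation annulus x a b := [set y : heis R | (a%R <= d x y <= b%R)%R].

Let m_cball x r : measurable (cball x r : set (heis_borel R)).
Proof. by apply: closed_heis_measurable; exact: closed_cball. Qed.

Let m_oball x r : measurable (oball x r : set (heis_borel R)).
Proof. by apply: open_heis_measurable; exact: open_mdist_lt. Qed.

Let closed_annulus x a b : closed (annulus x a b).
Proof.
rewrite (_ : annulus x a b = [set y | a <= d x y] `&` cball x b).
  by apply: closedI; [exact: closed_mdist_ge|exact: closed_cball].
by apply/seteqP; split => y /= => [/andP[]|[? ?]]; [split|apply/andP].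
Qed.

Let m_annulus x a b : measurable (annulus x a b : set (heis_borel R)).
Proof. by apply: closed_heis_measurable; exact: closed_annulus. Qed.

Let mass_add (A B C : set (heis_borel R)) (a b e : R) :
  measurable A -> measurable B -> measurable C ->
  (a%:E <= mu A)%E -> (b%:E <= mu B)%E -> (mu C <= e%:E)%E ->
  A `&` B `&` S = set0 -> A `&` S `<=` C -> B `&` S `<=` C -> a + b <= e.
Proof.
move=> mA mB mC aA bB Ce AB AC BC; rewrite -lee_fin EFinD.
apply: le_trans Ce; apply: le_trans (measure_spt_setU mA mB mC AB AC BC).
exact: leeD.
Qed.

Let mass_le (A C : set (heis_borel R)) (a e : R) :
  measurable A -> measurable C ->
  (a%:E <= mu A)%E -> (mu C <= e%:E)%E -> A `&` S `<=` C -> a <= e.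
Proof.
move=> mA mC aA Ce AC; rewrite -lee_fin (le_trans aA)// (le_trans _ Ce)//.
exact: le_measure_spt.
Qed.

(** The open ball contains the closed balls of all smaller radii, so it loses no mass: spheres
    centred in the support are null. *)
Lemma mu_oball x r : S x -> 0 < r -> mu (oball x r) = (c * r)%:E.
Proof.
move=> Sx r0; have le1 : (mu (oball x r) <= (c * r)%:E)%E.
  by rewrite -(mu_cball Sx r0); apply: le_measure_spt => // y [/ltW].
have fn : (mu (oball x r)) \is a fin_num.
  by rewrite ge0_fin_numE ?measure_ge0// (le_lt_trans le1)// ltry.
apply/eqP; rewrite eq_le le1 /=.
pose m := fine (mu (oball x r)); have mE : mu (oball x r) = m%:E by rewrite fineK.
have m0 : 0 <= m by rewrite fine_ge0// measure_ge0.
rewrite mE lee_fin leNgt; apply/negP => mr.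
have mc : m / c < r by rewrite ltr_pdivrMr// mulrC.
have mc0 : 0 <= m / c by rewrite divr_ge0// ltW.
(* If [m < c * r], the closed ball with radius halfway between [m / c] and [r] has mass above [m]
   inside the open ball of mass [m]. *)
have s0 : 0 < (r + m / c) / 2 by lra.
have : c * ((r + m / c) / 2) <= m.
  apply: (@mass_le (cball x ((r + m / c) / 2)) (oball x r)) => //.
  - by rewrite mu_cball.
  - by rewrite mE.
  - by move=> y [/= /le_lt_trans yr _]; apply: yr; lra.
have -> : c * ((r + m / c) / 2) = (c * r + m) / 2 by field; rewrite gt_eqF.
lra.
Qed.

(** The open ball of radius [a] takes the mass [c * a] away from that of [cball x b]. The degenerate
    case [a = b] expresses that spheres are null. *)
Lemma mu_annulus_le x a b : S x -> 0 < a <= b -> (mu (annulus x a b) <= (c * (b - a))%:E)%E.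
Proof.
move=> Sx /andP[a0 ab]; have b0 := lt_le_trans a0 ab.
have := @measure_spt_setU _ mu (oball x a) (annulus x a b) (cball x b).
rewrite mu_oball// mu_cball// => H.
have {H} : ((c * a)%:E + mu (annulus x a b) <= (c * b)%:E)%E.
  apply: H => //.
  - by apply/seteqP; split => // y [[/= ya /andP[]]]; rewrite leNgt ya.
  - by move=> y [/= /ltW ya _]; rewrite /cball/= (le_trans ya).
  - by move=> y [/= /andP[]].
by rewrite -leeBrDl// -EFinB -mulrBr.
Qed.

(** If the nearest point [z] of [S] outside the open ball had [d x z > r], then [oball x (d x z)]
    would contain no more of [S] than [cball x r], against their masses. The bound [r + 1] makes the
    search compact; a failure of the search is refuted in the same way. *)
Lemma sphere_spt x r : S x -> 0 < r -> exists2 z, S z & d x z = r.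
Proof.
move=> Sx r0.
have [[y [[Sy ry] yr]]|H] := pselect ((S `&` [set y | r <= d x y]) `&` cball x (r + 1) !=set0).
  have Kc : compact ((S `&` [set y | r <= d x y]) `&` cball x (r + 1)).
    rewrite setIC; apply: compact_closedI; first exact: heis_proper.
    by apply: closedI; [exact: closed_spt|exact: closed_mdist_ge].
  have [z [[Sz rz] zr] zmin] := compact_mdist_min x (ex_intro _ y (conj (conj Sy ry) yr)) Kc.
  exists z => //; apply/eqP; rewrite eq_le rz andbT leNgt; apply/negP => /= rz'.
  have : c * d x z <= c * r.
    apply: (@mass_le (oball x (d x z)) (cball x r)) => //.
    - by rewrite mu_oball// (lt_trans r0).
    - by rewrite mu_cball.
    - move=> w [/= wz Sw]; rewrite /cball/= leNgt; apply/negP => rw.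
      have := wz; rewrite ltNge => /negP; apply; apply: zmin.
      split; first by split=> //=; exact: ltW.
      by rewrite /cball/= ltW// (lt_le_trans wz).
  by rewrite ler_pM2l// leNgt rz'.
exfalso; have : c * (r + 1) <= c * r; last by rewrite ler_pM2l//; lra.
apply: (@mass_le (cball x (r + 1)) (cball x r)) => //.
- by rewrite mu_cball//; lra.
- by rewrite mu_cball.
- move=> w [wr Sw]; rewrite /cball/= leNgt; apply/negP => rw.
  by apply: H; exists w; split=> //; split => //=; exact: ltW.
Qed.

Lemma sphere_spt_le2 p r y1 y2 y3 : S p -> 0 < r -> S y1 -> S y2 -> S y3 ->
  d p y1 = r -> d p y2 = r -> d p y3 = r -> y1 <> y2 -> y1 <> y3 -> y2 = y3.
Proof.
move=> Sp r0 S1 S2 S3 p1 p2 p3 /eqP y12 /eqP y13; apply/eqP; apply: contrapT => /negP y23.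
move: y12 y13 y23; rewrite -!mdist_gt0 => d12 d13 d23.
(* The factor 3 makes the three balls disjoint, and [h <= r / 2] keeps the inner radius [r - h]
   positive. *)
have [h [h0 h1 h12 h13 h23]] : exists h : R, [/\ 0 < h, h <= r / 2,
    3 * h <= d y1 y2, 3 * h <= d y1 y3 & 3 * h <= d y2 y3].
  pose k : R := Num.min r (Num.min (d y1 y2) (Num.min (d y1 y3) (d y2 y3))).
  have [k0 k1 k12 k13 k23] : [/\ 0 < k, k <= r, k <= d y1 y2, k <= d y1 y3 & k <= d y2 y3].
    by rewrite /k !lt_min !ge_min !lexx !orbT; split=> //; apply/and4P.
  by exists (k / 3); split; lra.
have disj y z : 3 * h <= d y z -> cball y h `&` cball z h = set0.
  by move=> hyz; apply: cball_disjoint; lra.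
have sub y : d p y = r -> cball y h `&` S `<=` annulus p (r - h) (r + h).
  move=> py z [/= yz _]; move: yz; rewrite /cball /= => yz.
  have := metric_triangle p y z; have := metric_triangle p z y.
  by rewrite (metric_sym z y) py => *; apply/andP; lra.
have : (c * h + c * h) + c * h <= c * ((r + h) - (r - h)); last first.
  by have := mulr_gt0 c0 h0; lra.
apply: (@mass_add (cball y1 h `|` cball y2 h) (cball y3 h) (annulus p (r - h) (r + h))) => //.
- exact: measurableU.
- rewrite measureU//; last exact: disj.
  by rewrite EFinD; apply: leeD; [rewrite -(mu_cball S1 h0)|rewrite -(mu_cball S2 h0)].
- by rewrite mu_cball.
- by apply: mu_annulus_le => //; lra.
- by rewrite setIUl !disj// setU0 set0I.
- by rewrite setIUl => z [] /sub; apply.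
- exact: sub.
Qed.


(* The pair [(p, q)] realises the distance [e] between the two parts; the balls of radius
   [e] about [p] and [q] already exhaust the mass of the ball of radius [2 e]. *)
Let nearest_pair_ball (A B : set (heis R)) p q (e : R) : A `|` B = S -> A `&` B = set0 ->
  A p -> B q -> 0 < e -> d p q = e -> (forall x y, A x -> B y -> e <= d x y) ->
  forall z, d p z < 2 * e -> (A z -> d p z <= e) /\ (B z -> d q z <= e).
Proof.
move=> ABS AB0 Ap Bq e0 pq ABe.
have AB x : A x -> B x -> False.
  by move=> Ax Bx; have : (A `&` B) x by []; rewrite AB0.
have AS x : A x -> S x by move=> Ax; rewrite -ABS; left.
have BS x : B x -> S x by move=> Bx; rewrite -ABS; right.
have SA x y : A x -> S y -> d x y < e -> A y.
  by move=> Ax; rewrite -ABS => -[//|/(ABe _ _ Ax)]; rewrite leNgt => /negP.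
have SB x y : B x -> S y -> d x y < e -> B y.
  move=> Bx; rewrite -ABS => -[Ay|//]; have := ABe _ _ Ay Bx.
  by rewrite metric_sym leNgt => /negP.
(* A ball about [z] inside [cball p (2 * e)] that misses both balls of radius [e] on [S] would add
   [c * s] to a mass that is already full. *)
suff main z s : S z -> 0 < s -> d p z + s <= 2 * e ->
    oball p e `&` cball z s `&` S = set0 -> oball q e `&` cball z s `&` S = set0 -> False.
  move=> z pz; split => Hz; rewrite leNgt; apply/negP => ez.
  (* [s < e] keeps the points of [S] near [z] in [A], hence away from [oball q e]; [s <= d p z - e]
     keeps the ball about [z] away from [oball p e]. *)
  - have [s [s0 se s1 s2]] : exists s : R, [/\ 0 < s, s < e, d p z + s <= 2 * e & s <= d p z - e].
      exists (Num.min (e / 2) (Num.min (2 * e - d p z) (d p z - e))).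
      split; rewrite ?lt_min ?gt_min ?subr_gt0 ?pz ?ez ?divr_gt0//.
      + by apply/orP; left; lra.
      + by rewrite -lerBrDl !ge_min lexx !orbT.
      + by rewrite !ge_min lexx !orbT.
    apply: (main z s (AS _ Hz) s0 s1).
    + apply/seteqP; split => // w [[/= pw zw] _]; move: zw; rewrite /cball/= => zw.
      by have := metric_triangle p w z; rewrite (metric_sym w z) leNgt => /negP; apply; lra.
    + apply/seteqP; split => // w [[/= qw zw] Sw]; apply: (AB w).
        by apply: (SA z) => //; rewrite (le_lt_trans zw).
      exact: (SB q).
  - have [s [s0 se s1 s2]] : exists s : R, [/\ 0 < s, s < e, d p z + s <= 2 * e & s <= d q z - e].
      exists (Num.min (e / 2) (Num.min (2 * e - d p z) (d q z - e))).
      split; rewrite ?lt_min ?gt_min ?subr_gt0 ?pz ?ez ?divr_gt0//.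
      + by apply/orP; left; lra.
      + by rewrite -lerBrDl !ge_min lexx !orbT.
      + by rewrite !ge_min lexx !orbT.
    apply: (main z s (BS _ Hz) s0 s1).
    + apply/seteqP; split => // w [[/= pw zw] Sw]; apply: (AB w).
        exact: (SA p).
      by apply: (SB z) => //; rewrite (le_lt_trans zw).
    + apply/seteqP; split => // w [[/= pw zw] _]; move: zw; rewrite /cball/= => zw.
      by have := metric_triangle q w z; rewrite (metric_sym w z) leNgt => /negP; apply; lra.
move=> Sz s0 zs pz0 qz0.
have : (c * e + c * e) + c * s <= c * (2 * e); last first.
  by have := mulr_gt0 c0 s0; lra.
have e20 : 0 < 2 * e by lra.
(* The two open balls may overlap, but on [S] the first lies in [A] and the second in [B]. *)
have pq0 : oball p e `&` oball q e `&` S = set0.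
  apply/seteqP; split => // w [[/= pw qw] Sw]; apply: (AB w).
    exact: (SA p).
  exact: (SB q).
apply: (@mass_add (oball p e `|` oball q e) (cball z s) (cball p (2 * e))) => //.
- exact: measurableU.
- rewrite -(measure_sptI mu (measurableU _ _ (m_oball p e) (m_oball q e))) setIUl.
  rewrite measureU; first last.
  + by rewrite setIACA setIid.
  + by apply: measurableI => //; apply: closed_heis_measurable; exact: closed_spt.
  + by apply: measurableI => //; apply: closed_heis_measurable; exact: closed_spt.
  + rewrite EFinD; apply: leeD; [rewrite -(mu_oball (AS _ Ap) e0)|rewrite -(mu_oball (BS _ Bq) e0)];
      by rewrite -[leLHS]measure_sptI.
- by rewrite mu_cball.
- by rewrite (mu_cball (AS _ Ap)).
- by rewrite setIUl setIUl pz0 qz0 setU0.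
- move=> w [[/=|/=] pw _]; rewrite /cball/=.
    by rewrite (ltW (lt_trans pw _))//; lra.
  by have := metric_triangle p q w; lra.
- move=> w [/= + _]; rewrite /cball /= => zw.
  by have := metric_triangle p z w; lra.
Qed.

(** By [nearest_pair_ball] with [p] and [q] exchanged, on [S] the ball [oball x e] and a small ball
    about [y] lie in [cball q e]. If [d x y > e] they can be taken disjoint, with more mass than the
    available [c * e]. *)
Let nearest_pair_cluster (A B : set (heis R)) p q (e : R) : A `|` B = S -> A `&` B = set0 ->
  A p -> B q -> 0 < e -> d p q = e -> (forall x y, A x -> B y -> e <= d x y) ->
  forall x y, B x -> B y -> d q x <= e -> d q y <= e -> d x y <= e.
Proof.
move=> ABS AB0 Ap Bq e0 pq ABe x y Bx By qx qy; rewrite leNgt; apply/negP => exy.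
have BS z : B z -> S z by move=> Bz; rewrite -ABS; right.
have SB z w : B z -> S w -> d z w < e -> d q w < 2 * e -> B w /\ d q w <= e.
  move=> Bz; rewrite -ABS => -[Aw|Bw] zw qw.
    by have := ABe _ _ Aw Bz; rewrite metric_sym leNgt zw.
  split=> //; apply: (nearest_pair_ball _ _ Bq Ap e0 _ _ qw).1 => //.
  - by rewrite setUC.
  - by rewrite setIC.
  - by rewrite metric_sym.
  - by move=> x' y' Bx' Ay'; rewrite metric_sym; exact: ABe.
have [s [s0 se sxy]] : exists s : R, [/\ 0 < s, s < e & s <= d x y - e].
  exists (Num.min (e / 2) (d x y - e)).
  by rewrite lt_min gt_min ge_min !subr_gt0 exy lexx orbT divr_gt0//; split => //;
    apply/orP; left; lra.
have : c * e + c * s <= c * e; last by have := mulr_gt0 c0 s0; lra.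
apply: (@mass_add (oball x e) (cball y s) (cball q e)) => //.
- by rewrite mu_oball//; exact: BS.
- by rewrite mu_cball//; exact: BS.
- by rewrite mu_cball//; exact: BS.
- apply/seteqP; split => // w [[/= xw yw] _]; move: yw; rewrite /cball/= => yw.
  by have := metric_triangle x w y; rewrite (metric_sym w y) leNgt => /negP; apply; lra.
- move=> w [/= xw Sw]; apply: (SB x w _ _ _ _).2 => //.
  by have := metric_triangle q x w; lra.
- move=> w [/= + Sw]; rewrite /cball/= => yw; apply: (SB y w _ _ _ _).2 => //.
    exact: le_lt_trans yw se.
  by have := metric_triangle q y w; lra.
Qed.

(* Let [(p, q)] be a nearest pair. A point [z] of [B] farthest from [p] among those within
   [d p q] of [q] lies at distance [2 d p q] from [p], and some [w] in [A] lies at distance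
   [d p q] from both [p] and [z]: then [q] and [w] are two midpoints of [p] and [z]. *)
Lemma spt_no_compact_part (A B : set (heis R)) : compact A -> closed B ->
  A `|` B = S -> A `&` B = set0 -> A = set0.
Proof.
move=> Ac Bc ABS AB0; apply: contrapT => /eqP/set0P[p0 Ap0].
have AB x : A x -> B x -> False.
  by move=> Ax Bx; have : (A `&` B) x by []; rewrite AB0.
have AS x : A x -> S x by move=> Ax; rewrite -ABS; left.
have BS x : B x -> S x by move=> Bx; rewrite -ABS; right.
have [k Ak kmax] := compact_mdist_max p0 (ex_intro _ p0 Ap0) Ac.
(* A sphere about [p0] too large to meet [A] still contains a point of [S], which must lie in
   [B]. *)
have [q0 Bq0] : B !=set0.
  have k1 : 0 < d p0 k + 1 by rewrite ltr_pwDr// mdist_ge0.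
  have [z + p0z] := sphere_spt (AS _ Ap0) k1.
  by rewrite -ABS => -[/kmax|Bz]; [rewrite p0z; lra|exists z].
have [p [q [Ap Bq ABe]]] := proper_dist_attained (@heis_proper R) Ac
  (ex_intro _ p0 Ap0) Bc (ex_intro _ q0 Bq0).
have [e [e0 pq]] : exists e : R, 0 < e /\ d p q = e.
  exists (d p q); split => //; rewrite mdist_gt0; apply/eqP => pq.
  by apply: (AB p) => //; rewrite pq.
rewrite pq in ABe.
have near_p z : d p z < 2 * e -> (A z -> d p z <= e) /\ (B z -> d q z <= e).
  exact: (nearest_pair_ball ABS AB0 Ap Bq e0 pq ABe).
have BAS : B `|` A = S by rewrite setUC.
have BA0 : B `&` A = set0 by rewrite setIC.
have qp : d q p = e by rewrite metric_sym.
have BAe x y : B x -> A y -> e <= d x y by move=> Bx Ay; rewrite metric_sym; exact: ABe.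
have near_q z : d q z < 2 * e -> (B z -> d q z <= e) /\ (A z -> d p z <= e).
  exact: (nearest_pair_ball BAS BA0 Bq Ap e0 qp BAe).
have cluster := nearest_pair_cluster ABS AB0 Ap Bq e0 pq ABe.
have [z [qz Bz] zmax] : exists2 z, (cball q e `&` B) z &
    forall y, (cball q e `&` B) y -> d p y <= d p z.
  apply: compact_mdist_max; last by apply: compact_closedI => //; exact: heis_proper.
  by exists q; split => //; rewrite /cball/= mdistxx ltW.
rewrite /cball /= in qz.
have pzq := metric_triangle p q z.
(* Otherwise a sphere about [p] with radius strictly between [d p z] and [2 * e] and above [e]
   contains a point of [S]. By [near_p] it is not in [A], and in [B] it would beat the maximality of
   [z]. *)
have pz : d p z = 2 * e.
  apply/eqP; rewrite eq_le; apply/andP; split; first by lra.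
  rewrite leNgt; apply/negP => pz.
  have epz : e <= d p z.
    by rewrite -{1}pq; apply: zmax; split => //; rewrite /cball/= mdistxx ltW.
  have [r [er zr r2]] : exists r : R, [/\ e < r, d p z < r & r < 2 * e].
    exists ((d p z + 2 * e) / 2); have [h1 h2] := midf_lt pz.
    by split => //; rewrite (le_lt_trans epz).
  have [w Sw pw] := sphere_spt (AS _ Ap) (lt_trans e0 er).
  have [wA wB] : (A w -> d p w <= e) /\ (B w -> d q w <= e) by apply: near_p; lra.
  move: Sw; rewrite -ABS => -[/wA|Bw]; first by lra.
  by have := zmax w (conj (wB Bw) Bw); lra.
have qzE : d q z = e by apply/eqP; rewrite eq_le qz /=; lra.
have [w [pw Aw] wmin] : exists2 w, (cball p e `&` A) w &
    forall y, (cball p e `&` A) y -> d z w <= d z y.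
  apply: compact_mdist_min; last first.
    by rewrite setIC; apply: compact_closedI => //; exact: closed_cball.
  by exists p; split => //; rewrite /cball/= mdistxx ltW.
rewrite /cball /= in pw.
(* Otherwise [z] is moved slightly to a point [x] of [S] with [d q x < e], and a point [v] of [S] is
   taken at distance slightly above [e] from [x]. In [A] it would be closer to [z] than [w]; in [B]
   it would contradict [cluster]. *)
have zw : d z w <= e.
  rewrite leNgt; apply/negP => zw.
  have [s [s0 se szw]] : exists s : R, [/\ 0 < s, s < e & 3 * s <= d z w - e].
    pose t : R := Num.min e (d z w - e).
    have [t0 te tz] : [/\ 0 < t, t <= e & t <= d z w - e].
      by rewrite /t lt_min !ge_min !lexx orbT subr_gt0 zw e0.
    by exists (t / 3); split; lra.
  (* If no such [x] existed, a ball about [z] would meet [S] only in the null sphere of radius [e]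
     about [q]. *)
  have [x [Sx zx qx]] : exists x, [/\ S x, d z x <= s & d q x < e].
    apply: contrapT => nx.
    have : c * s <= c * (e - e); last by have := mulr_gt0 c0 s0; lra.
    apply: (@mass_le (cball z s) (annulus q e e)) => //.
    - by rewrite (mu_cball (BS _ Bz)).
    - by apply: mu_annulus_le; [exact: BS|rewrite e0 lexx].
    - move=> x [/= + Sx]; rewrite /cball /= => zx; apply/andP; split.
        by rewrite leNgt; apply/negP => qx; apply: nx; exists x.
      have [xB _] : (B x -> d q x <= e) /\ (A x -> d p x <= e).
        by apply: near_q; have := metric_triangle q z x; lra.
      apply: xB; move: Sx; rewrite -ABS => -[Ax|//].
      by have := BAe _ _ Bz Ax; lra.
  have Bx : B x.
    by move: Sx; rewrite -ABS => -[Ax|//]; have := BAe _ _ Bz Ax; lra.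
  have [r [er rs rx]] : exists r : R, [/\ e < r, r <= e + s & d q x + r < 2 * e].
    pose t : R := Num.min s ((e - d q x) / 2).
    have [t0 ts tx] : [/\ 0 < t, t <= s & t <= (e - d q x) / 2].
      by rewrite /t lt_min !ge_min !lexx orbT s0 /=; split => //; lra.
    by exists (e + t); split; lra.
  have [v Sv xv] := sphere_spt Sx (lt_trans e0 er).
  have [vB vA] : (B v -> d q v <= e) /\ (A v -> d p v <= e).
    by apply: near_q; have := metric_triangle q x v; lra.
  move: Sv; rewrite -ABS => -[Av|Bv].
    have := wmin v (conj (vA Av) Av); have := metric_triangle z x v; lra.
  by have := cluster x v Bx Bv (ltW qx) (vB Bv); lra.
have pwz := metric_triangle p w z; rewrite (metric_sym w z) in pwz.
apply: (AB w) => //; rewrite (_ : w = q)//.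
apply: (@heis_midpoint_unique _ p z w q e) => //.
- by apply/eqP; rewrite eq_le pw /=; lra.
- by rewrite metric_sym; apply/eqP; rewrite eq_le zw /=; lra.
Qed.

(* Disjoint balls of radius [h] with centres at distance [a + (2 i + 1) h] from [y] and
   missing [K] carry half of the mass of the annulus. *)
Lemma mu_annulus_half y (K : set (heis_borel R)) a b (e : R) : S y -> measurable K ->
  0 < a < b -> 0 < e ->
  (forall t, a < t < b -> exists z, [/\ S z, d y z = t & forall w : heis R, K w -> e <= d z w]) ->
  (mu (K `&` annulus y a b) <= (c * (b - a) / 2)%:E)%E.
Proof.
move=> Sy mK /andP[a0 ab] e0 Kfar.
(* [n] bands of width [2 * h] fill the annulus, and [n] is large enough for [h < e], so that the
   balls miss [K]. *)
pose n := (Num.bound ((b - a) / e)).+1.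
have n0 : 0 < n%:R :> R by rewrite ltr0n.
pose h := (b - a) / (2 * n%:R).
have h0 : 0 < h by rewrite divr_gt0 ?subr_gt0// mulr_gt0.
have nh : 2 * n%:R * h = b - a by rewrite mulrC divfK// mulf_neq0// gt_eqF.
have he : h < e.
  have : (b - a) / e < n%:R.
    rewrite (lt_le_trans (archi_boundP _)) ?ler_nat ?leqnSn//.
    by rewrite divr_ge0 ?ltW// subr_gt0.
  by rewrite ltr_pdivrMr// /h ltr_pdivrMr ?mulr_gt0//; nra.
have mD k : measurable (annulus y a k `\` K : set (heis_borel R)) by exact: measurableD.
(* Open balls are used: the next one is tangent to the closed annulus already packed, and must be
   disjoint from it. *)
have pack k : (k <= n)%N ->
    ((k%:R * (c * h))%:E <= mu (annulus y a (a + 2 * k%:R * h) `\` K))%E.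
  elim: k => [|k IHk] kn; first by rewrite mul0r measure_ge0.
  have kn' : k.+1%:R <= n%:R :> R by rewrite ler_nat.
  have kh : (k%:R + 1) * h <= n%:R * h by rewrite ler_pM2r// -natr1 in kn' *.
  have k0 : 0 <= k%:R * h by rewrite mulr_ge0 ?ler0n// ltW.
  have [|z [Sz yz Kz]] := Kfar (a + 2 * k%:R * h + h); first by apply/andP; lra.
  rewrite -natr1 mulrDl mul1r EFinD.
  apply: (@le_trans _ _ (mu (annulus y a (a + 2 * k%:R * h) `\` K) + mu (oball z h))%E).
    by apply: leeD; [exact: IHk (ltnW kn)|rewrite mu_oball].
  apply: measure_spt_setU => //.
  - apply/seteqP; split => // w [[[/= /andP[aw yw] _] zw] _].
    have := metric_triangle y w z; rewrite (metric_sym w z) leNgt => /negP; apply; lra.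
  - by move=> w [[/= /andP[aw yw] Kw] _]; split => //; apply/andP; lra.
  - move=> w [/= zw _]; split; last by move=> /Kz; lra.
    have := metric_triangle y w z; have := metric_triangle y z w.
    by rewrite (metric_sym w z) => *; apply/andP; lra.
have := pack _ (leqnn n); rewrite nh (addrC a) subrK.
rewrite (_ : n%:R * (c * h) = c * (b - a) / 2); last by rewrite -nh; field.
move=> H.
have : (mu (K `&` annulus y a b) + (c * (b - a) / 2)%:E <= (c * (b - a))%:E)%E.
  apply: (@le_trans _ _ (mu (K `&` annulus y a b) + mu (annulus y a b `\` K))%E).
    exact: leeD.
  have ab0 : 0 < a <= b by rewrite a0 ltW.
  apply: le_trans (mu_annulus_le Sy ab0).
  apply: measure_spt_setU => //; first exact: measurableI.
  - by apply/seteqP; split => // w [[[Kw _] [_ /(_ Kw)]]].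
  - by move=> w [[]].
  - by move=> w [[]].
by rewrite -leeBrDr// -EFinB => /le_trans; apply; rewrite lee_fin; lra.
Qed.

(* If [e] is a point of [D] farthest from [y], the mass that [mu_annulus_half] leaves to
   [D] near [e] is only half of that of the balls about [e], so [e] lies in [O]. *)
Lemma spt_no_compact_end (D O : set (heis R)) y : compact D -> closed D -> closed O ->
  D `|` O = S -> D `&` O = [set y] -> D = [set y].
Proof.
move=> Dc Dcl Ocl DOS DO.
have [Dy Oy] : D y /\ O y by have : (D `&` O) y by rewrite DO.
have Sy : S y by rewrite -DOS; left.
have DOy w : D w -> O w -> w = y.
  by move=> Dw Ow; have : (D `&` O) w by []; rewrite DO.
have [e De emax] := compact_mdist_max y (ex_intro _ y Dy) Dc.
apply/seteqP; split=> [w Dw|w ->//]; apply: contrapT => /= wy.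
have [s [s0 sE]] : exists s : R, 0 < s /\ d y e = s.
  exists (d y e); split => //; rewrite (lt_le_trans _ (emax _ Dw))// mdist_gt0.
  by apply/eqP => yw; apply: wy; rewrite yw.
rewrite sE in emax.
(* If [O] missed this sphere, [D] together with the part of [O] inside it would be a compact part of
   [S] separated from the rest. *)
have Osphere t : 0 < t -> exists2 z, O z & d y z = t.
  move=> t0; apply: contrapT => Ot.
  suff : D `|` (cball y t `&` O) = set0 by move=> /seteqP[/(_ y (or_introl Dy))].
  apply: (@spt_no_compact_part _ (O `&` [set z | t <= d y z])).
  - by apply: compactU => //; apply: compact_closedI => //; exact: heis_proper.
  - by apply: closedI => //; exact: closed_mdist_ge.
  - rewrite -DOS; apply/seteqP; split => z.
      by move=> [[|[]]|[]]; [left|right|right].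
    move=> [Dz|Oz]; first by left; left.
    by have [zt|/ltW zt] := leP (d y z) t; [left; right|right].
  - apply/seteqP; split => // z [[Dz|[zt Oz]] [Oz' /= tz]].
      by move: tz; rewrite (DOy _ Dz Oz') mdistxx leNgt t0.
    by apply: Ot; exists z => //; apply/eqP; rewrite eq_le zt.
have Se : S e by rewrite -DOS; left.
suff Oe : O e by move: s0; rewrite -sE (DOy _ De Oe) mdistxx ltxx.
apply: (closed_mdistP Ocl) => t0 t00.
have [t [t1 ts tt0]] : exists t : R, [/\ 0 < t, t < s & t <= t0].
  exists (Num.min t0 (s / 2)); split; rewrite ?lt_min ?gt_min ?ge_min ?lexx ?t00 ?divr_gt0//.
  by apply/orP; right; lra.
pose K : set (heis R) := D `&` [set w | s - t <= d y w].
have Kcl : closed K by apply: closedI => //; exact: closed_mdist_ge.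
have mK : measurable (K : set (heis_borel R)) by exact: closed_heis_measurable.
have Kc : compact K by apply: compact_closedI => //; exact: closed_mdist_ge.
have KO : K `&` O = set0.
  apply/seteqP; split => // z [[Dz /= sz] Oz]; move: sz.
  by rewrite (DOy _ Dz Oz) mdistxx; lra.
have [h h0 Kh] := compact_closed_separated (@heis_proper R) Kc Ocl KO.
have Khalf : (mu (K `&` annulus y (s - t) s) <= (c * (s - (s - t)) / 2)%:E)%E.
  apply: (mu_annulus_half _ _ _ h0) => //; first by apply/andP; lra.
  move=> r /andP[sr rs]; have [|z Oz yz] := Osphere r; first by lra.
  exists z; split => //; first by rewrite -DOS; right.
  by move=> w' Kw; rewrite metric_sym; exact: Kh.
have mD : measurable (D : set (heis_borel R)) by exact: closed_heis_measurable.
(* If [cball e t] met [S] only in [D], its mass [c * t] would be at most the [c * t / 2] of [Khalf].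
   So it contains a point of [O], for arbitrarily small [t]. *)
have [z [zt Dz] Sz] : exists2 z, (cball e t `\` D) z & S z.
  apply: contrapT => noz.
  have : c * t <= c * (s - (s - t)) / 2; last by have := mulr_gt0 c0 t1; lra.
  apply: (@mass_le (cball e t) (K `&` annulus y (s - t) s)) => //.
  - exact: measurableI.
  - by rewrite mu_cball.
  - move=> z [zt Sz]; have Dz : D z.
      by apply: contrapT => Dz; apply: noz; exists z.
    have sz : s - t <= d y z.
      have := metric_triangle y z e; rewrite sE (metric_sym z e).
      by move: zt; rewrite /cball /=; lra.
    by split => //=; rewrite sz emax.
exists z; first by move: Sz; rewrite -DOS => -[].
exact: le_trans zt tt0.
Qed.

Lemma spt_antipode p y r : S p -> S y -> 0 < r -> d p y = r ->
  exists e, [/\ S e, d p e = r & d y e = 2 * r].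
Proof.
move=> Sp Sy r0 py.
pose D : set (heis R) := cball p r `&` S.
pose O : set (heis R) := S `&` [set z | r <= d p z].
have Dc : compact D by apply: compact_closedI; [exact: heis_proper|exact: closed_spt].
have Dcl : closed D by apply: closedI; [exact: closed_cball|exact: closed_spt].
have Ocl : closed O by apply: closedI; [exact: closed_spt|exact: closed_mdist_ge].
have DO w : D w -> O w -> d p w = r.
  by move=> [pw _] [_ /= rw]; apply/eqP; rewrite eq_le rw andbT.
have Dy : D y by split => //; rewrite /cball/= py.
have Oy : O y by split => //=; rewrite py.
have DS w : S w -> D w \/ O w.
  by move=> Sw; have [pw|/ltW pw] := leP (d p w) r; [left|right].
(* If [O] missed this sphere, it would split into a compact [O1] around [y] and a closed [O2]. If
   [O2] misses [D], then [D] and [O1] form a forbidden compact part. Otherwise [D] meets [O] only in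
   [y] and one further point [y1] of [O2]; then [spt_no_compact_end] reduces first [O1] to [y], then
   [D] to [y1], although [y] is in [D]. *)
have Osphere t : 0 < t -> exists2 z, O z & d y z = t.
  move=> t0; apply: contrapT => Ot.
  pose O1 : set (heis R) := cball y t `&` O.
  pose O2 : set (heis R) := O `&` [set z | t <= d y z].
  have O1c : compact O1 by apply: compact_closedI => //; exact: heis_proper.
  have O1cl : closed O1 by apply: closedI => //; exact: closed_cball.
  have O2cl : closed O2 by apply: closedI => //; exact: closed_mdist_ge.
  have O1y : O1 y by split => //; rewrite /cball/= mdistxx ltW.
  have O12 w : O w -> O1 w \/ O2 w.
    by move=> Ow; have [yw|/ltW yw] := leP (d y w) t; [left|right].
  have nO12 w : O1 w -> O2 w -> False.
    by move=> [yw Ow] [_ wy]; apply: Ot; exists w => //; apply/eqP; rewrite eq_le yw.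
  have SD : D `<=` S by move=> w [].
  have SO1 : O1 `<=` S by move=> w [_ []].
  have SO2 : O2 `<=` S by move=> w [[]].
  have [[y1 [y1O2 Dy1]]|O2D] := pselect (O2 `&` D !=set0).
    have yy1 : y <> y1 by move=> yy1; apply: (@nO12 y) => //; rewrite yy1.
    have uniq w : D w -> O w -> w = y \/ w = y1.
      move=> Dw Ow; have [->|/eqP wy] := eqVneq w y; first by left.
      right; apply/esym; apply: (@sphere_spt_le2 p r y y1 w) => //; try exact: DO.
      - exact: SO2.
      - exact: SD.
      - by apply: DO => //; case: y1O2.
      - exact: nesym.
    have O1E : O1 = [set y].
      apply: (@spt_no_compact_end O1 (D `|` O2)) => //.
      - exact: closedU.
      - apply/seteqP; split=> w; first by move=> [/SO1|[/SD|/SO2]].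
        by move=> /DS[|/O12[]]; [right; left|left|right; right].
      - apply/seteqP; split => w.
          move=> [w1 [Dw|/(nO12 _ w1)//]]; case: (uniq w Dw w1.2) => // wy1.
          by exfalso; apply: (@nO12 w) => //; rewrite wy1.
        by move=> ->; split => //; left.
    have DE : D = [set y1].
      apply: (@spt_no_compact_end D O2) => //.
      - apply/seteqP; split=> w; first by move=> [/SD|/SO2].
        by move=> /DS[|/O12[]]; [left|rewrite O1E => ->; left|right].
      - apply/seteqP; split => w; last by move=> ->.
        move=> [Dw O2w]; case: (uniq w Dw O2w.1) => // wy.
        by exfalso; apply: (@nO12 w) => //; rewrite wy.
    by apply: yy1; have : D y by []; rewrite DE.
  suff : D `|` O1 = set0 by move=> /seteqP[/(_ y (or_introl Dy))].
  apply: (@spt_no_compact_part _ O2) => //.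
  - exact: compactU.
  - apply/seteqP; split=> w; first by move=> [[/SD|/SO1]|/SO2].
    by move=> /DS[|/O12[]]; [left; left|left; right|right].
  - apply/seteqP; split => // w [[Dw|/nO12 O1w] O2w]; last exact: O1w.
    by apply: O2D; exists w.
have [e De emax] := compact_mdist_max y (ex_intro _ y Dy) Dc.
have pe : d p e <= r by case: De.
have ye := metric_triangle y p e; rewrite (metric_sym y p) py in ye.
suff ye2 : 2 * r <= d y e.
  exists e; split; [by case: De|apply/eqP; rewrite eq_le pe /=; lra|].
  by apply/eqP; rewrite eq_le ye2 andbT; lra.
rewrite leNgt; apply/negP => yer.
(* The maximum with [r] keeps [s] positive even if [e = y]. *)
have [s [s0 es sr]] : exists s : R, [/\ 0 < s, d y e <= s & s < 2 * r].
  exists (Num.max (d y e) r); rewrite lt_max r0 orbT le_max lexx gt_max yer; split => //.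
  by rewrite /=; lra.
(* The ball [K] stays at distance [h] from [O]. On [S] it is covered by [cball y h] and its part of
   the annulus, of masses at most [c * h] and [c * s / 2]; with this [h] the sum falls short of
   [c * (r - h)] by [c * (2 * h)]. *)
pose h := (2 * r - s) / 8.
have [h0 hr] : 0 < h /\ h < r by rewrite /h; split; lra.
pose K : set (heis R) := cball p (r - h).
have mK : measurable (K : set (heis_borel R)) by exact: m_cball.
have ha : (mu (K `&` annulus y h (s + h)) <= (c * (s + h - h) / 2)%:E)%E.
  apply: (@mu_annulus_half _ _ _ _ h) => //; first by apply/andP; lra.
  move=> t /andP[ht _]; have [|z [Sz rz] yz] := Osphere t; first by lra.
  exists z; split => // w; rewrite /K /cball /= => pw.
  by move: rz => /=; have := metric_triangle p w z; rewrite (metric_sym w z); lra.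
have : c * (r - h) <= c * h + c * (s + h - h) / 2; last first.
  have -> : c * (r - h) = c * h + c * (s + h - h) / 2 + c * (2 * h) by rewrite /h; field.
  by have := mulr_gt0 c0 h0; lra.
have rh0 : 0 < r - h by lra.
rewrite -lee_fin EFinD -(mu_cball Sp rh0).
apply: (@le_trans _ _ (mu (cball y h) + mu (K `&` annulus y h (s + h)))%E); last first.
  by apply: leeD => //; rewrite mu_cball.
apply: le_trans (measureU2 _ _ _) => //; last exact: measurableI.
apply: le_measure_spt => //; first by apply: measurableU => //; exact: measurableI.
move=> w [Kw Sw]; have [wh|/ltW wh] := leP (d y w) h; [by left|right].
split => //; rewrite /= wh /=.
have Dw : D w by split => //; move: Kw; rewrite /K /cball /=; lra.
by have := emax _ Dw; lra.
Qed.

End one_uniform.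

(** * The support is a horizontal line *)

Section horizontal_line.
Context {R : realType}.
Implicit Types (x y z p : heis R) (a b s t : R).

Definition hline p a b t : heis R := (p * ((t * a, t * b, 0)%R : heis R))%g.

Lemma mdist_hline p a b s t : a ^+ 2 + b ^+ 2 = 1 ->
  mdist (hline p a b s) (hline p a b t) = `|t - s|.
Proof.
move=> ab; rewrite /hline hdist_mulgl /mdist/= /hdist.
have := hnorm4 (((s * a, s * b, 0)%R : heis R)^-1 * ((t * a, t * b, 0)%R : heis R))%g.
have -> : (((s * a, s * b, 0)%R : heis R)^-1 * ((t * a, t * b, 0)%R : heis R))%g =
    ((t - s) * a, (t - s) * b, 0) :> heis R.
  transitivity (hmul (hinv (s * a, s * b, 0)) (t * a, t * b, 0)) => //.
  by rewrite /hmul /hinv /=; congr (_, _, _); ring.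
move=> /= /eqP; rewrite expr0n addr0 !exprMn -mulrDr ab mulr1 -exprM => /eqP E.
apply/eqP; rewrite -(eqrXn2 (n := 4)) ?hnorm_ge0//; apply/eqP.
by rewrite E -normrX ger0_norm// (exprM _ 2 2) sqr_ge0.
Qed.

(** The scalar product of [(a, b)] with the horizontal part of [p^-1 * y]: for a unit vector, a
    1-Lipschitz left inverse of [hline]. *)
Definition hline_coord p a b y : R :=
  a * (p^-1 * y)%g.1.1 + b * (p^-1 * y)%g.1.2.

Lemma hline_coordK p a b : a ^+ 2 + b ^+ 2 = 1 -> cancel (hline p a b) (hline_coord p a b).
Proof.
move=> ab t; rewrite /hline_coord /hline mulKg /=.
by transitivity (t * (a ^+ 2 + b ^+ 2)); [ring|rewrite ab mulr1].
Qed.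

Lemma hline_coord_lip p a b x y : a ^+ 2 + b ^+ 2 = 1 ->
  `|hline_coord p a b y - hline_coord p a b x| <= mdist x y.
Proof.
move=> ab; have -> : hline_coord p a b y - hline_coord p a b x =
    a * (x^-1 * y)%g.1.1 + b * (x^-1 * y)%g.1.2.
  by rewrite /hline_coord /=; ring.
have -> : mdist x y = hnorm (x^-1 * y)%g by [].
move: (x^-1 * y)%g => [[u v] w]; have := hnorm4 ((u, v, w) : heis R).
have := hnorm_ge0 ((u, v, w) : heis R); move: (hnorm _) => n /= n0 nE.
have n2 : u ^+ 2 + v ^+ 2 <= n ^+ 2.
  rewrite -(ler_pXn2r (n := 2)) ?nnegrE ?sqr_ge0 ?addr_ge0 ?sqr_ge0//.
  by rewrite -exprM nE lerDl sqr_ge0.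
rewrite -(ler_pXn2r (n := 2)) ?nnegrE// real_normK ?num_real//.
apply: le_trans n2; rewrite -subr_ge0.
have -> : u ^+ 2 + v ^+ 2 - (a * u + b * v) ^+ 2 =
    (a * v - b * u) ^+ 2 + (1 - (a ^+ 2 + b ^+ 2)) * (u ^+ 2 + v ^+ 2) by ring.
by rewrite ab subrr mul0r addr0 sqr_ge0.
Qed.

Variable mu : {measure set (heis_borel R) -> \bar R}.
Variable c : R.
Hypothesis c0 : 0 < c.
Hypothesis mu_cball : forall (x : heis R) (r : R), spt mu x -> 0 < r ->
  mu (cball x r) = (c * r)%:E.
Local Notation S := (spt mu).

(** [x] is the midpoint of [y] and its antipode [e] on the sphere about [x], so strict convexity
    makes the increment from [y] to [x] horizontal. *)
Lemma spt_horizontal x y : S x -> S y -> (x^-1 * y)%g.2 = 0.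
Proof.
move=> Sx Sy; have [->|xy] := eqVneq x y; first by rewrite mulVg.
have r0 : 0 < mdist x y by rewrite mdist_gt0.
have [e [Se xe ye]] := spt_antipode c0 mu_cball Sx Sy r0 erefl.
have [_ h0] := heis_midpoint (metric_sym y x) xe ye.
transitivity (- (y^-1 * x)%g.2); last by rewrite h0 oppr0.
by rewrite /=; ring.
Qed.

(* For [x = p (v, 0)] and [y = p (w, 0)] in the support, the last coordinate of
   [x^-1 y] is [2 (v /\ w)], so all horizontal parts are parallel. *)
Lemma spt_hline p : S p -> exists a b, a ^+ 2 + b ^+ 2 = 1 /\ S = range (hline p a b).
Proof.
move=> Sp; have [u Su pu] := sphere_spt c0 mu_cball Sp ltr01.
have h0 := spt_horizontal Sp Su.
move: pu; rewrite /mdist/= /hdist => pu; have := hnorm4 (p^-1 * u)%g.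
rewrite pu expr1n h0 expr0n addr0.
have uE : u = (p * (p^-1 * u))%g by rewrite mulVKg.
case: (p^-1 * u)%g uE h0 pu => [[a b] k] /= uE k0 _ /esym ab4; subst k.
have ab : a ^+ 2 + b ^+ 2 = 1.
  apply/eqP; rewrite -(eqrXn2 (n := 2)) ?addr_ge0 ?sqr_ge0//; apply/eqP.
  by rewrite ab4 expr1n.
have SL w : S w -> exists t, w = hline p a b t.
  move=> Sw; have := spt_horizontal Sp Sw; have := spt_horizontal Su Sw.
  have -> : (u^-1 * w = ((a, b, 0)%R : heis R)^-1 * (p^-1 * w))%g.
    by rewrite uE invgM mulgA.
  have wE : w = (p * (p^-1 * w))%g by rewrite mulVKg.
  case: (p^-1 * w)%g wE => [[w1 w2] w3] wE /= par w30; subst w3.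
  exists (a * w1 + b * w2); rewrite wE /hline; congr (_ * _)%g.
  have {}par : a * w2 = b * w1 by lra.
  have e1 : w1 = (a * w1 + b * w2) * a.
    transitivity ((a ^+ 2 + b ^+ 2) * w1); first by rewrite ab mul1r.
    by transitivity (a ^+ 2 * w1 + b * (b * w1)); [ring|rewrite -par; ring].
  have e2 : w2 = (a * w1 + b * w2) * b.
    transitivity ((a ^+ 2 + b ^+ 2) * w2); first by rewrite ab mul1r.
    by transitivity (a * (a * w2) + b ^+ 2 * w2); [ring|rewrite par; ring].
  by rewrite -e1 -e2.
exists a, b; split => //; apply/seteqP; split => [w /SL[t ->]|_ [t _ <-]].
  by exists t.
have p0 : p = hline p a b 0.
  by rewrite /hline !mul0r; rewrite -[LHS]mulg1.
have [->|t0] := eqVneq t 0; first by rewrite -p0.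
(* Conversely, a point [y] of [S] at distance [|t|] from [p] and its antipode [e] have parameters
   [t] and [- t] in some order, so one of them is [hline p a b t]. *)
have [y Sy py] : exists2 y, S y & mdist p y = `|t|.
  by apply: (sphere_spt c0 mu_cball) => //; rewrite normr_gt0.
have [e [Se pe ye]] : exists e, [/\ S e, mdist p e = `|t| & mdist y e = 2 * `|t|].
  by apply: (spt_antipode c0 mu_cball) => //; rewrite normr_gt0.
have [s yE] := SL _ Sy; have [s' eE] := SL _ Se.
move: py pe ye; rewrite {1 2}p0 yE eE !mdist_hline// !subr0 => st s't sst.
have [<-|st'] := eqVneq s t; first by rewrite -yE.
suff -> : t = s' by rewrite -eE.
move: st st' s't sst.
move=> /eqP; rewrite eqr_norm2 => /orP[/eqP->|/eqP->]; first by rewrite eqxx.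
move=> _ /eqP; rewrite eqr_norm2 => /orP[/eqP->//|/eqP->].
rewrite subrr normr0 => /eqP.
by rewrite eq_sym mulf_eq0 pnatr_eq0 /= normr_eq0 (negPf t0).
Qed.

End horizontal_line.

(** * Spherical measure on isometric lines *)

Section isometric_line.
Context {R : realType} {T : metricType R}.

Lemma lebesgue_measure_le_diam (B : set R) (D : R) : measurable B -> 0 <= D ->
  (forall s t, B s -> B t -> t - s <= D) -> (lebesgue_measure B <= D%:E)%E.
Proof.
move=> mB D0 BD; have [->|/set0P[s Bs]] := eqVneq B set0.
  by rewrite measure0 lee_fin.
have lbB : has_inf B.
  by split; [exists s|exists (s - D) => t Bt; have := BD _ _ Bt Bs; lra].
have ubB : has_sup B.
  by split; [exists s|exists (s + D) => t Bt; have := BD _ _ Bs Bt; lra].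
have supinf : sup B <= inf B + D.
  apply: sup_le_ub; first by exists s.
  move=> t Bt; rewrite -lerBlDr; apply: lb_le_inf; first by exists s.
  by move=> u Bu; have := BD _ _ Bu Bt; lra.
apply: (@le_trans _ _ (lebesgue_measure (`[inf B, sup B] : set R))).
  apply: le_measure; rewrite ?inE// => t Bt; rewrite /= in_itv /=.
  by rewrite (ge_inf lbB.2 Bt) (ub_le_sup ubB.2 Bt).
rewrite lebesgue_measure_itv /= lte_fin; case: ifPn => // _.
by rewrite -EFinB lee_fin; lra.
Qed.

Variable f : R -> T.
Hypothesis f_isometric : forall s t, mdist (f s) (f t) = `|t - s|.

Lemma isometric_preimage_cball_measurable x r : measurable (f @^-1` cball x r : set R).
Proof.
apply: measurable_realfun.closed_measurable; apply: closed_comp; last exact: closed_cball.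
by move=> t _; exact: isometric_continuous.
Qed.

Lemma diam_ge0 (E : set T) : E !=set0 -> (0 <= diam E)%E.
Proof.
move=> [x Ex]; apply: ereal_sup_ubound; exists x => //; exists x => //.
by rewrite mdistxx.
Qed.

Lemma diam_cball_le (x : T) r : (diam (cball x r) <= (2 * r)%:E)%E.
Proof.
apply: ge_ereal_sup => _ [y xy [z xz <-]]; rewrite lee_fin.
rewrite (le_trans (metric_triangle y x z))// (metric_sym y x) mulrDl !mul1r.
exact: lerD.
Qed.

(** An integer part that puts the right end [u = N] into the last cell, as required for intervals
    closed on the right. *)
Lemma exists_nat_cell (N : nat) (u : R) : (0 < N)%N -> 0 <= u <= N%:R ->
  exists2 i, (i < N)%N & i%:R <= u <= i%:R + 1.
Proof.
elim: N => // N IH _ /andP[u0 uN]; have [Nu|uN'] := leP N%:R u.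
  by exists N => //; rewrite Nu natr1.
have [N0|N0] := posnP N; first by move: uN'; rewrite N0 ltNge u0.
have [|i iN iu] := IH N0; first by rewrite u0 ltW.
by exists i => //; exact: ltnW.
Qed.

(** Since [f] is isometric, the preimage of a ball has diameter, hence Lebesgue measure, at most the
    diameter of the ball. Countable subadditivity then bounds every cover. *)
Lemma lebesgue_le_spherical_premeasure (delta : R) (B : set R) : measurable B ->
  (lebesgue_measure B <= spherical_premeasure 1 delta (f @` B))%E.
Proof.
move=> mB; apply: le_ereal_inf_tmp => _ [I [E [Eball _ BE ->]]].
pose E' i := if i \in I then E i else set0.
have mE i : measurable (f @^-1` E' i : set R).
  rewrite /E'; case: ifPn => [/set_mem/Eball[x [r [_ ->]]]|_].
    exact: isometric_preimage_cball_measurable.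
  by rewrite preimage_set0.
have BE' : B `<=` \bigcup_i (f @^-1` E' i).
  move=> t Bt; have [i Ii Eit] : (\bigcup_(i in I) E i) (f t) by apply: BE; exists t.
  by exists i => //; rewrite /E' /= mem_set.
apply: (le_trans (measure_sigma_subadditive lebesgue_measure mE mB BE')).
rewrite esum_mkcond -nneseries_esumT; last first.
  by move=> i; case: ifPn => // _; exact: poweR_ge0.
apply: lee_nneseries => // i _; rewrite /E'.
case: ifPn => [/set_mem/Eball[x [r [r0 ->]]]|_]; last by rewrite preimage_set0 measure0.
have d0 : (0 <= diam (cball x r))%E.
  by apply: diam_ge0; exists x; rewrite /cball/= mdistxx ltW.
rewrite poweRe1// -(@fineK _ (diam (cball x r))); last first.
  by rewrite ge0_fin_numE// (le_lt_trans (diam_cball_le x r))// ltry.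
apply: lebesgue_measure_le_diam.
- exact: isometric_preimage_cball_measurable.
- exact: fine_ge0.
- move=> s t xs xt; rewrite (le_trans (ler_norm _))// -f_isometric -lee_fin fineK.
    by apply: ereal_sup_ubound; exists (f s) => //; exists (f t).
  by rewrite ge0_fin_numE// (le_lt_trans (diam_cball_le x r))// ltry.
Qed.

(* Each half-open interval of a cover is cut into pieces of length less than [delta]. *)
Lemma spherical_premeasure_le_lebesgue (delta : R) (B : set R) : 0 < delta ->
  (spherical_premeasure 1 delta (f @` B) <= lebesgue_measure B)%E.
Proof.
move=> delta0; rewrite /lebesgue_measure /lebesgue_stieltjes_measure /measure_extension.
apply: le_ereal_inf_tmp => _ [F [Fm BF] <-].
have {Fm} /choice[x Fx] : forall k, exists x : R * R, `]x.1, x.2]%classic = F k.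
  by move=> k; have [x _ xF] := Fm k; exists x.
pose l k : R := Num.max ((x k).2 - (x k).1) 0.
have l0 k : 0 <= l k by rewrite /l le_max lexx orbT.
have Fl k : wlength idfun (F k) = (l k)%:E.
  rewrite -Fx wlength_itv /= lte_fin /l; case: ifPn => [xx|].
    by rewrite max_l ?subr_ge0 ?ltW// EFinB.
  by rewrite -leNgt => xx; rewrite max_r// subr_le0.
(* Empty intervals get no piece, which keeps all radii [h k] in the cover positive; the others get
   more than [l k / delta] pieces, each of length [2 * h k < delta]. *)
pose N k := if (x k).1 < (x k).2 then (Num.bound (l k / delta)).+1 else 0%N.
pose h k : R := l k / (2 * (N k)%:R).
have hl k : (0 < N k)%N -> 2 * (N k)%:R * h k = l k.
  by move=> Nk; rewrite mulrC divfK// mulf_neq0// pnatr_eq0 -lt0n.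
have hN k : (0 < N k)%N -> 0 < h k /\ 2 * h k < delta.
  move=> Nk; have N0 : 0 < (N k)%:R :> R by rewrite ltr0n.
  have lk : 0 < l k.
    by rewrite /l lt_max; move: Nk; rewrite /N; case: ifPn => // xx _; rewrite subr_gt0 xx.
  split; first by rewrite divr_gt0// mulr_gt0.
  have : l k / delta < (N k)%:R.
    move: Nk; rewrite /N; case: ifPn => // _ _.
    by rewrite (lt_trans (archi_boundP _)) ?ltr_nat// divr_ge0// ltW.
  by rewrite ltr_pdivrMr// -(hl _ Nk) => H; rewrite -(ltr_pM2l N0); lra.
pose ctr (k i : nat) := (x k).1 + (2 * i%:R + 1) * h k.
(* Pairs of an interval and a piece are coded by naturals, as the covers are indexed by sets of
   naturals. *)
pose E n := if (choice.unpickle n : option (nat * nat)) is Some (k, i) then cball (f (ctr k i)) (h k)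
  else set0.
pose P := [set: nat] `*`` (fun k => [set i | (i < N k)%N]).
pose I := (choice.pickle : nat * nat -> nat) @` P.
have EI k i : E (choice.pickle (k, i)) = cball (f (ctr k i)) (h k) by rewrite /E choice.pickleK.
have Pgt0 k i : P (k, i) -> (0 < N k)%N by move=> [_ /= iN]; exact: leq_ltn_trans iN.
apply: (@le_trans _ _ (\esum_(n in I) (diam (E n) `^ 1))%E).
  apply: ereal_inf_lbound; exists I, E; split => //.
  - move=> _ [[k i] Pki <-]; rewrite EI; exists (f (ctr k i)), (h k); split => //.
    by have [] := hN _ (Pgt0 _ _ Pki).
  - move=> _ [[k i] Pki <-]; rewrite EI (le_lt_trans (diam_cball_le _ _))// lte_fin.
    by have [] := hN _ (Pgt0 _ _ Pki).
  - move=> _ [t /BF[k _] Fkt <-].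
    move: Fkt; rewrite -Fx /= in_itv /= => /andP[xt tx].
    have xx := lt_le_trans xt tx.
    have lE : l k = (x k).2 - (x k).1 by rewrite /l max_l// subr_ge0 ltW.
    have Nk : (0 < N k)%N by rewrite /N xx.
    have [h0 _] := hN _ Nk.
    pose u := (t - (x k).1) / (2 * h k).
    have h20 : 0 < 2 * h k by rewrite mulr_gt0.
    have uE : 2 * h k * u = t - (x k).1 by rewrite mulrC divfK// gt_eqF.
    have [i iN /andP[iu ui]] : exists2 i, (i < N k)%N & i%:R <= u <= i%:R + 1.
      apply: exists_nat_cell => //; apply/andP; split.
        by rewrite /u divr_ge0// ?subr_ge0 ltW.
      by rewrite /u ler_pdivrMr// mulrCA mulrA (hl _ Nk) lE lerD2r.
    exists (choice.pickle (k, i)); first by exists (k, i).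
    rewrite EI /cball /= f_isometric ler_norml /ctr; apply/andP.
    have := ler_wpM2l (ltW h20) iu; have := ler_wpM2l (ltW h20) ui; rewrite uE.
    by lra.
rewrite esum_image; last by move=> p q _ _; exact: (pcan_inj choice.pickleK).
apply: (@le_trans _ _ (\esum_(p in P) (fun k (i : nat) => (2 * h k)%:E) p.1 p.2)%E).
  apply: le_esum => -[k i] Pki; rewrite EI poweRe1; last first.
    apply: diam_ge0; exists (f (ctr k i)); rewrite /cball/= mdistxx ltW//.
    by have [] := hN _ (Pgt0 _ _ Pki).
  exact: diam_cball_le.
have h_ge0 k : 0 <= h k by rewrite divr_ge0// mulr_ge0.
rewrite -(@esum_esum _ _ _ setT (fun k => `I_(N k)) (fun k _ => (2 * h k)%:E)); last first.
  by move=> k i _ _; rewrite lee_fin mulr_ge0.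
rewrite (eq_eseriesr (fun k _ => Fl k)) nneseries_esumT; last by move=> k; rewrite lee_fin.
apply: le_esum => k _; rewrite esum_fset//; last first.
  by move=> i _; rewrite lee_fin mulr_ge0.
rewrite -fsbig_ord sumEFin lee_fin sumr_const card_ord.
have [N0|Nk] := posnP (N k); first by rewrite N0 mulr0n.
by rewrite -(hl _ Nk) -mulr_natl; lra.
Qed.

End isometric_line.

(** * Uniform measures carried by a horizontal line *)

Section line_measure.
Context {R : realType}.
Variables (p : heis R) (a b : R).
Hypothesis ab : a ^+ 2 + b ^+ 2 = 1.

Lemma hline_coord_continuous : continuous (hline_coord p a b).
Proof.
by apply: lipschitz1_continuous => x y; exact: hline_coord_lip.
Qed.

Lemma hline_coord_measurable :
  measurable_fun [set: heis_borel R] (hline_coord p a b : heis_borel R -> measurableTypeR R).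
Proof.
apply: (measurability _ (measurable_realfun.RGenOInfty.measurableE R)) => _ [_ [t ->] <-].
rewrite setTI; apply: open_heis_measurable.
apply: (@open_comp _ _ (hline_coord p a b : heis R -> R)); last exact: interval_open.
by move=> x _; exact: hline_coord_continuous.
Qed.

Lemma hline_measurable :
  measurable_fun [set: measurableTypeR R] (hline p a b : measurableTypeR R -> heis_borel R).
Proof.
apply: (@measurability _ _ _ (heis_borel R) setT _ (@open (heis R)) erefl) => _ [U Uo <-].
rewrite setTI; apply: measurable_realfun.open_measurable.
apply: (@open_comp _ _ (hline p a b : R -> heis R)) => // t _.
by apply: isometric_continuous => s u; exact: mdist_hline.
Qed.

Variable mu : {measure set (heis_borel R) -> \bar R}.
Variable c : R.
Hypothesis c0 : 0 < c.
Hypothesis mu_cball : forall (x : heis R) (r : R), spt mu x -> 0 < r ->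
  mu (cball x r) = (c * r)%:E.
Hypothesis spt_line : spt mu = range (hline p a b).

Let pi : heis_borel R -> measurableTypeR R := hline_coord p a b.

(** Lebesgue measure is determined by its values on half-open intervals. On the line, such an
    interval lies between the open and the closed ball about its midpoint, both of mass [c] times
    half its length. *)
Lemma mu_hline (B : set R) : measurable B ->
  mu (hline_coord p a b @^-1` B) = ((c / 2)%:E * lebesgue_measure B)%E.
Proof.
move=> mB.
have mpi := hline_coord_measurable.
have k0 : 0 <= 2 / c by rewrite divr_ge0// ltW.
pose nu : {measure set (measurableTypeR R) -> \bar R} := mscale (NngNum k0) (pushforward mu pi).
have S0 t : spt mu (hline p a b t) by rewrite spt_line; exists t.
have hpi : cancel (hline p a b) pi by exact: hline_coordK.
have mpre (A : set R) : measurable A -> measurable (pi @^-1` A : set (heis_borel R)).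
  by move=> mA; rewrite -[X in measurable X]setTI; exact: mpi.
have lebE : lebesgue_measure B = nu mpi B.
  apply: lebesgue_measure_unique => // _ [[s t] _ <-] /=.
  rewrite lebesgue_measure_itv /= lte_fin /mscale /= /pushforward.
  case: ifPn => [st|]; last first.
    rewrite -leNgt => ts; rewrite set_itv_ge; last by rewrite bnd_simp -leNgt.
    by rewrite preimage_set0 measure0 mule0.
  set m := (s + t) / 2; set r := (t - s) / 2.
  have r0 : 0 < r by rewrite /r; lra.
  have dm u : mdist (hline p a b m) (hline p a b u) = `|u - m| by exact: mdist_hline.
  have -> : mu (pi @^-1` `]s, t]%classic) = (c * r)%:E.
    apply/eqP; rewrite eq_le; apply/andP; split.
      rewrite -(mu_cball (S0 m) r0); apply: le_measure_spt => //.
      - exact: mpre.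
      - by apply: closed_heis_measurable; exact: closed_cball.
      - move=> x [+ Sx]; move: Sx; rewrite spt_line => -[u _ <-] /=; rewrite hpi in_itv /= /cball /= dm.
        by move=> /andP[su ut]; rewrite ler_norml /m /r; apply/andP; lra.
    rewrite -(mu_oball c0 mu_cball (S0 m) r0); apply: le_measure_spt => //.
    - by apply: open_heis_measurable; exact: open_mdist_lt.
    - exact: mpre.
    - move=> x [+ Sx]; move: Sx; rewrite spt_line => -[u _ <-] /=; rewrite hpi in_itv /= dm.
      by rewrite ltr_norml /m /r => /andP[mu1 mu2]; apply/andP; lra.
  by rewrite -EFinB -EFinM; congr EFin; rewrite /r; field; rewrite gt_eqF.
rewrite lebE /nu /mscale /= /pushforward muleA -EFinM.
rewrite (_ : c / 2 * (2 / c) = 1) ?mul1e//.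
by field; rewrite gt_eqF.
Qed.

(** For every positive [delta] the premeasure of a subset of the line equals the Lebesgue measure of
    its parameters [B], so the limit is that of a constant. The factor [c / 2] compares the mass
    [c * r] with the length [2 * r]. *)
Lemma mu_spherical (A : set (heis_borel R)) : measurable A ->
  mu A = ((c / 2)%:E * spherical_measure 1 (A `&` spt mu : set (heis R)))%E.
Proof.
move=> mA; pose B : set R := hline p a b @^-1` A.
have mB : measurable B by rewrite -[X in measurable X]setTI; exact: hline_measurable.
have iso s t : mdist (hline p a b s) (hline p a b t) = `|t - s| by exact: mdist_hline.
have ASE : A `&` spt mu = hline p a b @` B.
  rewrite spt_line; apply/seteqP; split=> [x [Ax [t _ tx]]|_ [t At <-]].
    by exists t => //; rewrite /B /= tx.
  by split => //; exists t.
have mpre : measurable (hline_coord p a b @^-1` B : set (heis_borel R)).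
  by rewrite -[X in measurable X]setTI; exact: hline_coord_measurable.
have -> : mu A = mu (hline_coord p a b @^-1` B).
  apply/eqP; rewrite eq_le; apply/andP; split; apply: le_measure_spt => //;
    by move=> x [+ Sx]; move: Sx; rewrite spt_line => -[t _ <-]; rewrite /B /= hline_coordK.
rewrite (mu_hline mB); congr (_ * _)%E; rewrite /spherical_measure.
apply/esym/cvg_lim => //; apply: cvg_near_cst; near=> delta.
have delta0 : 0 < delta by near: delta; exact: nbhs_right_gt.
apply/eqP; rewrite eq_le; apply/andP; split.
  by rewrite ASE; exact: spherical_premeasure_le_lebesgue.
by rewrite ASE; exact: lebesgue_le_spherical_premeasure.
Unshelve. all: by end_near. Qed.

End line_measure.

Theorem theorem1p3 (R : realType)
    (mu : {measure set (heis_borel R) -> \bar R}) :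
  uniform_measure 1 mu ->
  exists L : set (heis R), affine_horizontal_line L /\
    exists k : R, 0 < k /\
      forall A : set (heis_borel R), measurable A ->
        mu A = (k%:E * spherical_measure 1 (A `&` L : set (heis R)))%E.
Proof.
move=> [mu0 [c [c0 mu_cball']]].
have mu_cball (x : heis R) (r : R) : spt mu x -> 0 < r -> mu (cball x r) = (c * r)%:E.
  by move=> Sx r0; rewrite mu_cball'// powRr1// ltW.
have [p _ Sp] : exists2 p, [set: heis R] p & spt mu p.
  by apply: measure_spt_neq0 => //; rewrite lt0e measure_ge0 andbT; apply/eqP.
have [a [b [ab SL]]] := spt_hline c0 mu_cball Sp.
exists (spt mu); split.
  exists p, a, b; split => // -[a0 b0].
  by move: ab; rewrite a0 b0 expr0n addr0 => /eqP; rewrite eq_sym oner_eq0.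
exists (c / 2); split; first exact: divr_gt0.
by move=> A mA; apply: (@mu_spherical R p a b ab).
Qed.
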